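(* Let $k\ge 2$ be an integer and let $p(k)=\frac{(\beta+\gamma)k}{2}$. Let $\hat C>0$, $\tilde C>0$, $A>0$ be constants such that, with $C_1,C_2,C_3,C_4,\overline{C}_0,\overline{C}_1$ as defined in the context, $$1-C_L\left(C_3+C_1\overline{C}_0\right)\ \ge\ C_LC_3\overline{C}_1,\qquad A-C_L\left(C_4+C_2\overline{C}_0\right)\ \ge\ C_LC_4\overline{C}_1 .$$ Then, for every time step-size $\tau>0$, the $k$-th order numerical scheme $$\frac{du^{n+1}(t)}{dt}+\epsilon\mathcal{L}u^{n+1}(t)+A\tau^k\frac{d}{dt}\mathcal{L}^{p(k)}u^{n+1}(t)=\sum_{i=0}^{k-1}\ell_i(t-t_n)\,\mathcal{N}(u^{n-i}),\qquad t\in[t_n,t_{n+1}],\quad u^{n+1}(t_n)=u^n,\quad u^{n+1}:=u^{n+1}(t_{n+1}),$$ is energy stable in the sense that $$\tilde E(u^{n+1})\le\tilde E(u^n)\qquad\text{for all } n\ge k,$$ where the modified energy is $$\tilde E(u^n)=E(u^n)+C_LC_3\sum_{j=1}^{k-1}\overline{C}_j\left\|\frac{du^{n-j+1}(t)}{dt}\right\|^2_{L^2(t_{n-j},t_{n-j+1};H)}+C_LC_4\sum_{j=1}^{k-1}\overline{C}_j\,\tau^k\left\|\frac{du^{n-j+1}(t)}{dt}\right\|^2_{L^2(t_{n-j},t_{n-j+1};V^{p(k)})}.$$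
   Context: Setting. $H$ is a real Hilbert space and $\mathcal{L}$ is a self-adjoint, positive definite (bounded below by a positive multiple of the identity) linear operator on $H$. For $\alpha\ge0$, $V^\alpha$ is the domain of $\mathcal{L}^{\alpha/2}$ with norm $\|v\|_{V^\alpha}=\|\mathcal{L}^{\alpha/2}v\|_H$ (so $V^0=H$), and $V^{-\alpha}$ is the dual of $V^\alpha$ with the duality induced by the inner product of $H$. Fix $\epsilon>0$. The gradient flow is $\frac{du}{dt}=-\epsilon\mathcal{L}u+\mathcal{N}(u)$, where the nonlinear map $\mathcal{N}:V^\gamma\to V^{-\beta}$ is Lipschitz: there are $\beta>0$, $\gamma>0$, $C_L>0$ with $$\|\mathcal{N}(u)-\mathcal{N}(v)\|_{V^{-\beta}}\le C_L\|u-v\|_{V^\gamma}\qquad\forall u,v\in V^\gamma .$$ $E$ is the energy functional of the flow, i.e. its variational derivative in $H$ is $\frac{\delta E}{\delta u}=\epsilon\mathcal{L}u-\mathcal{N}(u)$. Time discretization. $\tau>0$ is the uniform step-size, $t_n=n\tau$. The shifted Lagrange basis polynomials are $$\ell_i(s)=\prod_{0\le m\le k-1,\ m\ne i}\frac{m+s/\tau}{m-i},\qquad 0\le i\le k-1 .$$ For each $m\ge1$, $u^m(\cdot)$ denotes a function on $[t_{m-1},t_m]$ with $u^m(t_{m-1})=u^{m-1}$ and $u^m(t_m)=u^m$; for $m\ge k$ it is given by the scheme, and for $1\le m\le k-1$ (starting steps) it is any given function joining the starting values. Regularity. With $s=\max\{1,\beta,\gamma,p(k)\}$, each $u^m(\cdot)$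 belongs to $H^1(t_{m-1},t_m;V^s)$, the scheme holds in $V^{-s}$ for a.e. $t$, and $E$ is defined on $V^s$ and satisfies the chain rule: for $w\in H^1(a,b;V^s)$, $t\mapsto E(w(t))$ is absolutely continuous with $\frac{d}{dt}E(w(t))=\langle\epsilon\mathcal{L}w(t)-\mathcal{N}(w(t)),w'(t)\rangle$ for a.e. $t$, where $\langle\cdot,\cdot\rangle$ is the duality pairing extending the inner product of $H$. Constants. Set $C_0^*=1$ and for $1\le j\le k-1$ let $C_j^*\ge 0$ be defined by $$\Big\|1-\sum_{i=0}^{j-1}\ell_i(t-t_n)\Big\|_{L^2(t_n,t_{n+1})}=C_j^*\,\tau^{1/2}$$ ($C_j^*$ is independent of $\tau$ and $n$). Let $\overline{C}_j=\sum_{r=0}^{k-1-j}C^*_{k-1-r}$ for $0\le j\le k-1$. For $\hat C,\tilde C>0$ let $$C_1=\tfrac{1-\beta/p(k)}{2}\,\hat C^{1/(1-\beta/p(k))},\quad C_2=\tfrac{\beta}{2p(k)}\,\hat C^{-p(k)/\beta},\quad C_3=\tfrac{1-\gamma/p(k)}{2}\,\tilde C^{1/(1-\gamma/p(k))},\quad C_4=\tfrac{\gamma}{2p(k)}\,\tilde C^{-p(k)/\gamma}.$$ *)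

(* Defs.v *)
From HB Require Import structures.
From mathcomp Require Import all_boot all_order all_algebra.
From mathcomp Require Import all_classical all_reals all_analysis.

Set Implicit Arguments.
Unset Strict Implicit.
Unset Printing Implicit Defensive.

Import Order.TTheory GRing.Theory Num.Theory.
Import numFieldNormedType.Exports.

Local Open Scope classical_set_scope.
Local Open Scope ring_scope.

(* An unbounded operator is a domain D together with a function on H that is
   only meaningful on D. *)
Section Operators.
Context {R : realType} {H : completeNormedModType R}.
Variable ip : H -> H -> R.

(* Densely defined, linear, and equal to its adjoint, domains included: the
   pairs (y, z) with <L x, y> = <x, z> for all x in D form the graph of L^*. *)
Definition self_adjoint (D : set H) (L : H -> H) : Prop :=
  [/\ D 0 /\ (forall (a : R) x y, D x -> D y -> D (a *: x + y)),
      (forall (a : R) x y, D x -> D y -> L (a *: x + y) = a *: L x + L y),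
      dense D &
      forall y z, (forall x, D x -> ip (L x) y = ip x z) <-> (D y /\ z = L y)].

Definition positive_definite (D : set H) (L : H -> H) : Prop :=
  exists2 c : R, 0 < c & forall x, D x -> c * `|x| ^+ 2 <= ip (L x) x.

(* <P(A) x, x> when P A is an orthogonal projection; the squared norm is
   nonnegative also on non-measurable sets A, where P A is unconstrained. *)
Definition spectral_mass (P : set R -> H -> H) (x : H)
    (A : set (measurableTypeR R)) : \bar R := (`|P A x| ^+ 2)%:E.

Record spectral_measure := SpectralMeasure {
  sproj :> set R -> H -> H ;
  sproj_linear : forall A : set (measurableTypeR R), measurable A ->
    forall (a : R) x y, sproj A (a *: x + y) = a *: sproj A x + sproj A y ;
  sproj_sym : forall A : set (measurableTypeR R), measurable A ->
    forall x y, ip (sproj A x) y = ip x (sproj A y) ;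
  sprojI : forall A B : set (measurableTypeR R), measurable A -> measurable B ->
    forall x, sproj (A `&` B) x = sproj A (sproj B x) ;
  sproj0 : forall x, sproj set0 x = 0 ;
  sprojT : forall x, sproj setT x = x ;
  sproj_sigma_additive : forall x, semi_sigma_additive (spectral_mass sproj x) }.

Definition smeas (P : spectral_measure) (x : H) := spectral_mass P x.

Section SmeasMeasure.
Variables (P : spectral_measure) (x : H).

Let smeas0 : smeas P x set0 = 0%E.
Proof. by rewrite /smeas /spectral_mass sproj0 normr0 expr0n. Qed.

Let smeas_ge0 A : (0 <= smeas P x A)%E.
Proof. by rewrite lee_fin exprn_ge0. Qed.

Let smeas_sigma_additive : semi_sigma_additive (smeas P x).
Proof. exact: sproj_sigma_additive. Qed.

HB.instance Definition _ :=
  isMeasure.Build _ _ _ (smeas P x) smeas0 smeas_ge0 smeas_sigma_additive.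

End SmeasMeasure.

(* For f >= 0 measurable: the vector \int f dP x is the limit of the integrals
   of the usual dyadic simple functions increasing to f. *)
Definition spectral_sum (P : spectral_measure) (f : R -> R) (n : nat) (x : H) : H :=
  \sum_(0 <= i < n * 2 ^ n)
    (i%:R / 2 ^+ n) *: P (f @^-1` `[i%:R / 2 ^+ n, i.+1%:R / 2 ^+ n[) x.

Definition spectral_integral (P : spectral_measure) (f : R -> R) (x : H) : H :=
  lim (spectral_sum P f n x @[n --> \oo]).

Definition spectral_dom (P : spectral_measure) (f : R -> R) : set H :=
  [set x | (\int[smeas P x]_l ((f l) ^+ 2)%:E < +oo)%E].

(* P is the resolution of the identity of the positive operator L, given by
   the spectral theorem: L = \int l dP(l) over [0, +oo[, domains included. *)
Definition spectral_resolution (D : set H) (L : H -> H)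
    (P : spectral_measure) : Prop :=
  [/\ forall x, P `]-oo, 0[%classic x = 0,
      D = spectral_dom P id &
      forall x, D x -> L x = spectral_integral P id x].

Definition Lpow (P : spectral_measure) (a : R) : H -> H :=
  spectral_integral P (fun l => l `^ a).

Definition Vsp (P : spectral_measure) (a : R) : set H :=
  spectral_dom P (fun l => l `^ (a / 2)).

Definition Vnorm (P : spectral_measure) (a : R) (x : H) : R :=
  `|Lpow P (a / 2) x|.

(* An element of V^-a is represented by a function on H that is only
   meaningful on V^a; an element h of H acts as v |-> <h, v>. *)
Definition Vdual (P : spectral_measure) (a : R) (phi : H -> R) : Prop :=
  (forall (c : R) x y, Vsp P a x -> Vsp P a y ->
     phi (c *: x + y) = c * phi x + phi y) /\
  (exists M : R, forall v, Vsp P a v -> `|phi v| <= M * Vnorm P a v).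

Definition Vdual_norm (P : spectral_measure) (a : R) (phi : H -> R) : R :=
  sup [set `|phi v| | v in [set v | Vsp P a v /\ Vnorm P a v <= 1]].

(* <L^a u, v> for the bounded extension L^a : V^a -> V^-a. *)
Definition Lpair (P : spectral_measure) (a : R) (u v : H) : R :=
  ip (Lpow P (a / 2) u) (Lpow P (a / 2) v).

End Operators.

Section Bochner.
Context {R : realType} {H : completeNormedModType R} {ip : H -> H -> R}.
Notation mu := (@lebesgue_measure R).

Definition simple_in (X : set H) (g : R -> H) : Prop :=
  [/\ finite_set (range g), range g `<=` X &
      forall x, @measurable _ (measurableTypeR R) (g @^-1` [set x])].

Definition strongly_measurable (P : spectral_measure ip) (s a b : R)
    (f : R -> H) : Prop :=
  exists2 g : nat -> R -> H, forall n, simple_in (Vsp P s) (g n) &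
    forall t, a < t < b -> Vnorm P s (g n t - f t) @[n --> \oo] --> (0 : R).

(* w is (the continuous representative of) an element of H^1(a, b; V^s) and w'
   a representative of dw/dt: w' is in L^2(a, b; V^s) and
   w(t) = w(a) + \int_a^t w' for t in [a, b].  The Bochner integral is tested
   against the elements of H, which separate the points of V^s; w is then
   continuous into V^s, so that w itself is in L^2.  Every class in
   L^2(a, b; V^s) has a representative that is an everywhere limit of Borel
   simple functions. *)
Definition is_H1 (P : spectral_measure ip) (s a b : R) (w w' : R -> H) : Prop :=
  [/\ forall t, a <= t <= b -> Vsp P s (w t),
      forall t, a < t < b -> Vsp P s (w' t),
      strongly_measurable P s a b w',
      (\int[mu]_(t in `]a, b[) (Vnorm P s (w' t) ^+ 2)%:E < +oo)%E &
      forall t, a <= t <= b -> forall z,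
        ip (w t) z = ip (w a) z + \int[mu]_(r in `]a, t[) ip (w' r) z].

Definition sq_L2norm (nrm : H -> R) (a b : R) (f : R -> H) : R :=
  \int[mu]_(t in `]a, b[) (nrm (f t) ^+ 2).

End Bochner.

Definition absolutely_continuous {R : realType} (a b : R) (F : R -> R) : Prop :=
  forall e : R, 0 < e -> exists2 d : R, 0 < d &
    forall (n : nat) (l r : 'I_n -> R),
      (forall i, [/\ a <= l i, l i <= r i & r i <= b]) ->
      trivIset setT (fun i => `]l i, r i[%classic : set R) ->
      \sum_(i < n) (r i - l i) < d ->
      \sum_(i < n) `|F (r i) - F (l i)| < e.

Section GradientFlow.
Context {R : realType} {H : completeNormedModType R} {ip : H -> H -> R}.
Variable P : spectral_measure ip.
Notation mu := (@lebesgue_measure R).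

Definition lipschitz_nonlinearity (beta gamma CL : R) (N : H -> H -> R) : Prop :=
  (forall u, Vsp P gamma u -> Vdual P beta (N u)) /\
  (forall u v, Vsp P gamma u -> Vsp P gamma v ->
     Vdual_norm P beta (fun x => N u x - N v x) <= CL * Vnorm P gamma (u - v)).

(* <dE/du (u), v> with dE/du = eps L u - N(u). *)
Definition dE (eps : R) (N : H -> H -> R) (u v : H) : R :=
  eps * Lpair P 1 u v - N u v.

Definition variational_derivative (eps s : R) (N : H -> H -> R)
    (E : H -> R) : Prop :=
  forall u v, Vsp P s u -> Vsp P s v ->
    is_derive (0 : R) (1 : R) (fun h : R => E (u + h *: v)) (dE eps N u v).

Definition chain_rule (eps s : R) (N : H -> H -> R) (E : H -> R) : Prop :=
  forall (a b : R) (w w' : R -> H), a < b -> is_H1 P s a b w w' ->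
    absolutely_continuous a b (E \o w) /\
    {ae mu, forall t, a < t < b ->
       is_derive t (1 : R) (E \o w) (dE eps N (w t) (w' t))}.

Definition lagrange_basis (k : nat) (tau : R) (i : nat) (s : R) : R :=
  \prod_(0 <= m < k | m != i) ((m%:R + s / tau) / (m%:R - i%:R)).

Definition tn (tau : R) (n : nat) : R := n%:R * tau.

(* The scheme on [t_n, t_{n+1}] in V^-s for a.e. t, with w = u^{n+1}(.) and
   w' = dw/dt.  As L^p : V^s -> V^-s is bounded, d/dt L^p w = L^p w'. *)
Definition scheme_step (eps A tau s p : R) (k : nat) (N : H -> H -> R)
    (u : nat -> H) (n : nat) (w w' : R -> H) : Prop :=
  {ae mu, forall t, tn tau n < t < tn tau n.+1 -> forall v, Vsp P s v ->
     ip (w' t) v + eps * Lpair P 1 (w t) v + A * tau ^+ k * Lpair P p (w' t) v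
     = \sum_(0 <= i < k) lagrange_basis k tau i (t - tn tau n) * N (u (n - i)%N) v}.

Definition pk (beta gamma : R) (k : nat) : R := (beta + gamma) * k%:R / 2.

Definition regularity (beta gamma : R) (k : nat) : R :=
  Num.max 1 (Num.max beta (Num.max gamma (pk beta gamma k))).

Definition is_Cstar (k : nat) (Cs : nat -> R) : Prop :=
  Cs 0%N = 1 /\
  forall j : nat, (1 <= j <= k.-1)%N -> 0 <= Cs j /\
    forall (tau : R) (n : nat), 0 < tau ->
      Num.sqrt (\int[mu]_(t in `]tn tau n, tn tau n.+1[)
        (1 - \sum_(0 <= i < j) lagrange_basis k tau i (t - tn tau n)) ^+ 2)
      = Cs j * Num.sqrt tau.

Definition Cbar (k : nat) (Cs : nat -> R) (j : nat) : R :=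
  \sum_(0 <= r < (k.-1 - j).+1) Cs (k.-1 - r)%N.

(* Young constants: C_1 = young_fst beta p(k) Chat, C_3 = young_fst gamma p(k)
   Ctilde, C_2 = young_snd beta p(k) Chat, C_4 = young_snd gamma p(k) Ctilde. *)
Definition young_fst (a p c : R) : R := (1 - a / p) / 2 * c `^ (1 / (1 - a / p)).
Definition young_snd (a p c : R) : R := a / (2 * p) * c `^ (- (p / a)).

Definition modified_energy (E : H -> R) (CL C3 C4 p tau : R) (k : nat)
    (Cs : nat -> R) (u : nat -> H) (dU : nat -> R -> H) (n : nat) : R :=
  E (u n)
  + CL * C3 * (\sum_(1 <= j < k) Cbar k Cs j *
      sq_L2norm (fun x : H => `|x|) (tn tau (n - j)) (tn tau (n - j).+1)
        (dU (n - j).+1))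
  + CL * C4 * (\sum_(1 <= j < k) Cbar k Cs j * (tau ^+ k *
      sq_L2norm (Vnorm P p) (tn tau (n - j)) (tn tau (n - j).+1)
        (dU (n - j).+1))).

End GradientFlow.

(* Main.v *)
Require Import Defs.
From mathcomp Require Import all_boot all_order all_algebra.
From mathcomp Require Import all_classical all_reals all_analysis.
From mathcomp Require Import measurable_realfun ring lra zify.
Import Order.TTheory GRing.Theory Num.Theory.
Import numFieldNormedType.Exports.
Local Open Scope classical_set_scope.
Local Open Scope ring_scope.

(* Testing the scheme against w' = du^{n+1}/dt and using that the Lagrange basis
   sums to 1, Abel summation gives, with l_i the shifted basis and x_0 = w(t),
   x_{j+1} = u^{n-j},
     dE(w)/dt = - |w'|^2 - A tau^k |w'|_p^2
                + sum_{j<k} (1 - sum_{i<j} l_i) <N(x_{j+1}) - N(x_j), w'>.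
   Each increment x_{j+1} - x_j is bounded in V^gamma by tau^{1/2} times the L^2
   norm of du/dt on one earlier step, and the interpolation inequality
   |v|_a^2 <= C |v|^{2(1-a/p)} |v|_p^{2a/p} in its Young form, with the powers of
   tau balanced by (beta + gamma) k / p = 2, turns every term into |du/dt|^2 and
   tau^k |du/dt|_p^2.  Integrating in time, the terms of the earlier steps are
   absorbed by telescoping the sums in the modified energy.
   The fractional powers are controlled through the dyadic spectral sums S_n:
   |S_n x|^2 increases to the integral of f^2 against the spectral measure. *)

(** * Dyadic spectral sums *)

(** Three obstacles shape the proof. The identity [w(t) = w(a) + \int w'] is available only after
    pairing with vectors of [H], whereas [L^{gamma/2}] is unbounded; the sums [S_n] are symmetric
    and defined on all of [H], so [S_n (S_n d)] is an admissible test vector, and the increment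
    bound is proved for [S_n] uniformly in [n]. The energy is differentiable along the flow only
    almost everywhere; as one inequality suffices, the energy minus an integral is shown to be
    nonincreasing, absolute continuity serving to cross the null set. Finally, the squared
    coefficients integrate to the square of [Cs j] times [tau], so the Young weight balancing the
    j-th product is [Cs j] itself, which is where the constants of the modified energy come from.
    Positivity of [L] enters as a gap in the spectrum, by which [V^s] controls the weaker norms; the
    resulting constant secures measurability and integrability and does not appear in the energy
    estimate. *)

Section Dyadic.
Context {R : realType}.
Implicit Types (f : R -> R) (n m : nat) (l : R).

Definition dyadic_cell f n i : set R :=
  f @^-1` `[i%:R / 2 ^+ n, i.+1%:R / 2 ^+ n[.

(** The scalar counterpart of [spectral_sum]: for [f >= 0] it rounds [f] down to a multiple of
    [2^-n], with cutoff at height [n]. *)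
Definition dyadic f n l : R :=
  \sum_(0 <= i < n * 2 ^ n) i%:R / 2 ^+ n * \1_(dyadic_cell f n i) l.

(** The cells are disjoint: [l] lies only in the one of index [truncn (f l * 2 ^+ n)], which is in
    range exactly when [f l < n]. *)
Lemma dyadicE f n l : 0 <= f l ->
  dyadic f n l =
  if f l < n%:R then (Num.truncn (f l * 2 ^+ n))%:R / 2 ^+ n else 0.
Proof.
move=> f0; have p2 : 0 < 2 ^+ n :> R by rewrite exprn_gt0.
have fp0 : 0 <= f l * 2 ^+ n by rewrite mulr_ge0// ltW.
have cellE i : l \in dyadic_cell f n i = (Num.truncn (f l * 2 ^+ n) == i).
  rewrite /dyadic_cell; apply/idP/eqP => [|<-].
    rewrite inE/= in_itv/= ler_pdivrMr// ltr_pdivlMr//.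
    by move=> /truncn_def.
  by rewrite inE/= in_itv/= ler_pdivrMr// ltr_pdivlMr//; exact: truncn_itv.
rewrite /dyadic; set t := Num.truncn _ in cellE *.
have tlt : (t < n * 2 ^ n)%N = (f l < n%:R).
  by rewrite /t truncn_lt_nat// natrM natrX ltr_pM2r.
rewrite -tlt; case: ifPn => tn.
  rewrite (big_rem t) ?mem_index_iota//=.
  rewrite indicE cellE eqxx mulr1 big_seq_cond big1 ?addr0// => i.
  rewrite mem_rem_uniq ?iota_uniq// andbT !inE => /andP[it _].
  by rewrite indicE cellE eq_sym (negbTE it) mulr0.
rewrite big_seq_cond big1// => i; rewrite mem_index_iota andbT/= => itn.
rewrite indicE cellE; case: eqP => [ti|]; last by rewrite mulr0.
by rewrite ti itn in tn.
Qed.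

Lemma dyadic_ge0 f n l : 0 <= dyadic f n l.
Proof. by apply: sumr_ge0 => i _; rewrite mulr_ge0// divr_ge0// exprn_ge0. Qed.

Lemma dyadic_le f n l : 0 <= f l -> dyadic f n l <= f l.
Proof.
move=> f0; rewrite dyadicE//; case: ifPn => // _.
by rewrite ler_pdivrMr ?exprn_gt0// truncn_le// mulr_ge0// exprn_ge0.
Qed.

(** Past the cutoff the coarser value is 0; below it, [2^(m-n)] times the coarser index is an
    integer not above [f l * 2^m], hence at most the finer index. *)
Lemma dyadic_nondecreasing f n m l : 0 <= f l -> (n <= m)%N ->
  dyadic f n l <= dyadic f m l.
Proof.
move=> f0 nm; rewrite [leLHS]dyadicE//; case: ifPn => [fn|_]; last exact: dyadic_ge0.
rewrite dyadicE// (lt_le_trans fn) ?ler_nat//.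
have p2 k : 0 < 2 ^+ k :> R by rewrite exprn_gt0.
have fp k : 0 <= f l * 2 ^+ k by rewrite mulr_ge0// ltW.
have : (Num.truncn (f l * 2 ^+ n) * 2 ^ (m - n) <= Num.truncn (f l * 2 ^+ m))%N.
  rewrite truncn_ge_nat// natrM natrX -[in leRHS](subnK nm) exprD mulrCA mulrC.
  by rewrite ler_pM2l// truncn_le.
rewrite -(ler_nat R) natrM natrX => h.
rewrite ler_pdivlMr// (le_trans _ h)// -[in leLHS](subnK nm) exprD.
by rewrite [_ ^+ (m - n) * _]mulrC mulrA divfK ?gt_eqF.
Qed.

Lemma dyadic_cvg f l : 0 <= f l -> dyadic f n l @[n --> \oo] --> f l.
Proof.
move=> f0; apply/cvgrPdist_lt => e e0.
near=> n.
have fn : f l < n%:R.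
  near: n; exists (Num.truncn (f l)).+1 => //= k /= fk.
  by rewrite (lt_le_trans (truncnS_gt _))// ler_nat.
rewrite ger0_norm ?subr_ge0 ?dyadic_le// dyadicE// fn.
apply: (@lt_trans _ _ (1 / 2 ^+ n)); last first.
  by near: n; exact: near_infty_natSinv_expn_lt (PosNum e0).
rewrite ltrBlDr -mulrDl nat1r ltr_pdivlMr ?exprn_gt0//; exact: truncnS_gt.
Unshelve. all: by end_near. Qed.

Lemma measurable_dyadic_cell f n i :
  measurable_fun [set: R] f -> measurable (dyadic_cell f n i).
Proof.
by move=> mf; rewrite /dyadic_cell -[X in measurable X]setTI; exact: mf.
Qed.

Lemma measurable_dyadic f n :
  measurable_fun [set: R] f -> measurable_fun [set: R] (dyadic f n).
Proof.
move=> mf; apply: measurable_sum => i; apply: measurable_funM => //.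
by apply: measurable_indic; exact: measurable_dyadic_cell.
Qed.

End Dyadic.

(** * Isometry and convergence of the spectral sums *)

Section SpectralSum.
Context {R : realType} {H : completeNormedModType R} (ip : {dot H for idfun}).
Hypothesis ip_norm : forall x : H, ip x x = `|x| ^+ 2.
Variable P : spectral_measure ip.
Implicit Types (f : R -> R) (x y z : H).

Lemma ip_sym x y : ip x y = ip y x.
Proof. by rewrite hermC/= expr0 mul1r. Qed.

Lemma ipDl x y z : ip (x + y) z = ip x z + ip y z.
Proof. exact: (linearDl ip). Qed.

Lemma ipBl x y z : ip (x - y) z = ip x z - ip y z.
Proof. exact: (linearBl ip). Qed.

Lemma ipZl (a : R) x z : ip (a *: x) z = a * ip x z.
Proof. exact: (linearZl_LR ip). Qed.

Lemma ipDr x y z : ip z (x + y) = ip z x + ip z y.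
Proof. by rewrite ip_sym ipDl !(ip_sym z). Qed.

Lemma ipBr x y z : ip z (x - y) = ip z x - ip z y.
Proof. by rewrite ip_sym ipBl !(ip_sym z). Qed.

Lemma ipZr (a : R) x z : ip z (a *: x) = a * ip z x.
Proof. by rewrite ip_sym ipZl (ip_sym z). Qed.

Lemma ip_suml I (r : seq I) (F : I -> H) z :
  ip (\sum_(i <- r) F i) z = \sum_(i <- r) ip (F i) z.
Proof.
apply: (big_morph (ip^~ z)) => [x y|]; first exact: ipDl.
by rewrite -(subrr 0) ipBl subrr.
Qed.

Lemma ip_sumr I (r : seq I) (F : I -> H) z :
  ip z (\sum_(i <- r) F i) = \sum_(i <- r) ip z (F i).
Proof. by rewrite ip_sym ip_suml; apply: eq_bigr => i _; rewrite ip_sym. Qed.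

(** Expansion of [|q x - y|^2 >= 0]. The free weight [q] is tuned in each use: for Cauchy-Schwarz,
    for the spectral gap, and for an absorption in the displacement estimate. *)
Lemma ip_le x y (q : R) : 0 < q ->
  ip x y <= (q * `|x| ^+ 2 + `|y| ^+ 2 / q) / 2.
Proof.
move=> q0.
have : 0 <= `|q *: x - y| ^+ 2 by rewrite exprn_ge0.
rewrite -(ip_norm (_ - _)) ipBl !ipBr !ipZl !ipZr !ip_norm.
rewrite (ip_sym y x) => h.
have : 0 <= (q * (q * `|x| ^+ 2) - q * ip x y - (q * ip x y - `|y| ^+ 2)) / q.
  by rewrite divr_ge0// ltW.
rewrite (_ : _ / q = q * `|x| ^+ 2 - 2 * ip x y + `|y| ^+ 2 / q).
  by move=> h'; lra.
by field; rewrite gt_eqF.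
Qed.

Lemma ip_sproj (A B : set (measurableTypeR R)) x :
  measurable A -> measurable B -> ip (P A x) (P B x) = `|P (A `&` B) x| ^+ 2.
Proof.
move=> mA mB; have mAB := measurableI _ _ mA mB.
rewrite sproj_sym// -sprojI// -[in LHS](setIid (A `&` B)) sprojI//.
by rewrite -sproj_sym// ip_norm.
Qed.

Let cell_measurable f n i : measurable_fun [set: R] f ->
  measurable (dyadic_cell f n i : set (measurableTypeR R)).
Proof. exact: measurable_dyadic_cell. Qed.

Lemma spectral_sum_linear f n : measurable_fun [set: R] f ->
  forall (a : R) x y, spectral_sum P f n (a *: x + y) =
    a *: spectral_sum P f n x + spectral_sum P f n y.
Proof.
move=> mf a x y; rewrite /spectral_sum scaler_sumr -big_split/=.
apply: eq_bigr => i _; rewrite sproj_linear//; last exact: cell_measurable.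
by rewrite scalerDr !scalerA mulrC.
Qed.

Lemma spectral_sum_sym f n : measurable_fun [set: R] f -> forall x y,
  ip (spectral_sum P f n x) y = ip x (spectral_sum P f n y).
Proof.
move=> mf x y; rewrite /spectral_sum ip_suml ip_sumr.
apply: eq_bigr => i _; rewrite ipZl ipZr sproj_sym//.
exact: cell_measurable.
Qed.

(** The projections of two cells pair to the measure of their intersection, so both sides are the
    same double sum. Two levels [n] and [m] are allowed because the Cauchy estimate compares
    them. *)
Lemma spectral_sum_ip f n m x : measurable_fun [set: R] f ->
  (ip (spectral_sum P f n x) (spectral_sum P f m x))%:E =
  (\int[smeas P x]_l (dyadic f n l * dyadic f m l)%:E)%E.
Proof.
move=> mf.
rewrite /spectral_sum ip_suml.
have mcell k i := cell_measurable f k i mf.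
have cge0 (i k : nat) : 0 <= i%:R / 2 ^+ k :> R.
  by rewrite divr_ge0// exprn_ge0.
under [RHS]eq_integral do rewrite mulr_suml -sumEFin.
rewrite ge0_integral_sum//; last 2 first.
- move=> i; apply/measurable_EFinP; apply: measurable_funM.
    by apply: measurable_funM => //; apply: measurable_indic; exact: mcell.
  exact: measurable_dyadic.
- by move=> i l _; rewrite lee_fin !mulr_ge0// ?dyadic_ge0.
rewrite -sumEFin; apply: eq_bigr => i _.
rewrite ip_sumr -sumEFin.
under [RHS]eq_integral do rewrite mulr_sumr -sumEFin.
rewrite ge0_integral_sum//; last first.
- move=> j; apply/measurable_EFinP; apply: measurable_funM.
    by apply: measurable_funM => //; apply: measurable_indic; exact: mcell.
  by apply: measurable_funM => //; apply: measurable_indic; exact: mcell.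
apply: eq_bigr => j _.
rewrite ipZl ipZr ip_sproj//; [|exact: mcell..].
under eq_integral => l _.
  rewrite mulrACA EFinM (_ : \1_ _ l * \1_ _ l =
    \1_(dyadic_cell f n i `&` dyadic_cell f m j) l); last by rewrite indicI.
  over.
rewrite ge0_integralZl_EFin ?mulr_ge0//; last first.
  by apply/measurable_EFinP/measurable_indic; apply: measurableI; exact: mcell.
rewrite integral_indic//; last by apply: measurableI; exact: mcell.
by rewrite setIT mulrA EFinM.
Qed.

Lemma spectral_sum_norm f n x : measurable_fun [set: R] f ->
  (`|spectral_sum P f n x| ^+ 2)%:E =
  (\int[smeas P x]_l (dyadic f n l ^+ 2)%:E)%E.
Proof. by move=> mf; rewrite -ip_norm spectral_sum_ip. Qed.

Variable f : R -> R.
Hypotheses (mf : measurable_fun [set: R] f) (f0 : forall l, 0 <= f l).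
Let S := spectral_sum P f.

Lemma spectral_sum_norm_nondecreasing n m x : (n <= m)%N ->
  `|S n x| ^+ 2 <= `|S m x| ^+ 2.
Proof.
move=> nm; rewrite -lee_fin !spectral_sum_norm//.
have md k : measurable_fun [set: measurableTypeR R] (fun l => (dyadic f k l ^+ 2)%:E).
  by apply/measurable_EFinP; apply: measurable_funX; exact: measurable_dyadic.
apply: ge0_le_integral => // l _; first by rewrite lee_fin sqr_ge0.
by rewrite lee_fin lerXn2r ?nnegrE ?dyadic_ge0// dyadic_nondecreasing.
Qed.

(* The cross term of |S m x - S n x|^2 is at least |S n x|^2, since the dyadic
   approximations increase. *)
Lemma spectral_sum_dist n m x : (n <= m)%N ->
  `|S m x - S n x| ^+ 2 <= `|S m x| ^+ 2 - `|S n x| ^+ 2.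
Proof.
move=> nm.
have : `|S n x| ^+ 2 <= ip (S n x) (S m x).
  rewrite -lee_fin spectral_sum_norm// spectral_sum_ip//.
  have md k k' : measurable_fun [set: measurableTypeR R]
      (fun l => (dyadic f k l * dyadic f k' l)%:E).
    by apply/measurable_EFinP; apply: measurable_funM; exact: measurable_dyadic.
  apply: ge0_le_integral => //.
  - by move=> l _; rewrite lee_fin sqr_ge0.
  - exact: md.
  - by move=> l _; rewrite lee_fin expr2 ler_wpM2l ?dyadic_ge0// dyadic_nondecreasing.
rewrite -!ip_norm ipBl !ipBr (ip_sym (S m x) (S n x)) => h.
lra.
Qed.

(** Monotone convergence, valid for every [x]: off the domain the limit is [+oo], which allows the
    domain to be read off the sums. *)
Lemma spectral_sum_norm_cvg x :
  (`|S n x| ^+ 2)%:E @[n --> \oo] --> (\int[smeas P x]_l (f l ^+ 2)%:E)%E.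
Proof.
under eq_cvg do rewrite spectral_sum_norm//.
have -> : (\int[smeas P x]_l (f l ^+ 2)%:E =
    \int[smeas P x]_l (limn (fun n => (dyadic f n l ^+ 2)%:E)))%E.
  apply: eq_integral => l _; apply/esym/cvg_lim => //.
  apply: cvg_EFin; first by near=> n.
  apply: (@cvg_comp _ _ _ (fun n => dyadic f n l) (fun y : R => y ^+ 2)).
    exact: dyadic_cvg.
  exact: exprn_continuous.
apply: cvg_monotone_convergence => //.
- by move=> n; apply/measurable_EFinP; apply: measurable_funX; exact: measurable_dyadic.
- by move=> n l _; rewrite lee_fin sqr_ge0.
- move=> l _ n m nm.
  by rewrite lee_fin lerXn2r ?nnegrE ?dyadic_ge0// dyadic_nondecreasing.
Unshelve. all: by end_near. Qed.

Lemma spectral_sum_norm_le x : spectral_dom P f x -> forall n,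
  `|S n x| ^+ 2 <= fine (\int[smeas P x]_l (f l ^+ 2)%:E)%E.
Proof.
move=> xf n; rewrite -lee_fin fineK; last first.
  by rewrite ge0_fin_numE//; apply: integral_ge0 => l _; rewrite lee_fin sqr_ge0.
rewrite spectral_sum_norm//; apply: ge0_le_integral => //.
- by move=> l _; rewrite lee_fin sqr_ge0.
- by apply/measurable_EFinP; apply: measurable_funX; exact: measurable_dyadic.
- by apply/measurable_EFinP; exact: measurable_funX.
- by move=> l _; rewrite lee_fin lerXn2r ?nnegrE ?dyadic_ge0// dyadic_le.
Qed.

(** The measure [smeas P x] is quadratic in [x], which hides the linearity of the domain;
    boundedness of the linear maps [S n] along [x] shows it. *)
Lemma spectral_domP x :
  spectral_dom P f x <-> exists M, forall n, `|S n x| ^+ 2 <= M.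
Proof.
split=> [xf|[M xM]]; first by eexists; exact: spectral_sum_norm_le.
rewrite /spectral_dom/=; apply: (@le_lt_trans _ _ M%:E); last exact: ltry.
have /cvg_lim <- // := spectral_sum_norm_cvg x.
apply: lime_le; first by apply/cvg_ex; eexists; exact: spectral_sum_norm_cvg.
by apply: nearW => n; rewrite lee_fin.
Qed.

Lemma spectral_dom_linear (a : R) x y :
  spectral_dom P f x -> spectral_dom P f y -> spectral_dom P f (a *: x + y).
Proof.
move=> /spectral_domP[M xM] /spectral_domP[M' yM']; apply/spectral_domP.
exists (2 * (a ^+ 2 * M + M')) => n; rewrite /S spectral_sum_linear//.
(* Parallelogram law; the subtracted square is then dropped. *)
have -> : `|a *: S n x + S n y| ^+ 2 =
    2 * (a ^+ 2 * `|S n x| ^+ 2 + `|S n y| ^+ 2) - `|a *: S n x - S n y| ^+ 2.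
  rewrite -!ip_norm ipBl !ipBr ipDl !ipDr.
  rewrite !ipZl !ipZr (ip_sym (S n y) (S n x)); ring.
rewrite lerBlDr -[leLHS]addr0 lerD ?exprn_ge0// ler_wpM2l// lerD//.
by rewrite ler_wpM2l ?sqr_ge0.
Qed.

(** By [spectral_sum_dist], squared distances are at most increments of the bounded nondecreasing
    sequence [|S n x|^2]; hence the sums are Cauchy, with threshold [e ^+ 2] for the squares. *)
Lemma spectral_integral_cvg x : spectral_dom P f x ->
  S n x @[n --> \oo] --> spectral_integral P f x.
Proof.
move=> xf; suff : cvg (S n x @[n --> \oo]) by [].
apply/cauchy_cvgP/cauchy_ballP => e e0.
have : cvg ((`|S n x| ^+ 2 : R) @[n --> \oo]).
  apply: nondecreasing_is_cvgn.
    by move=> n m; exact: spectral_sum_norm_nondecreasing.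
  by exists (fine (\int[smeas P x]_l (f l ^+ 2)%:E)%E) => _ [n _ <-]; exact: spectral_sum_norm_le.
move=> /cauchy_cvgP/cauchy_ballP => /(_ (e ^+ 2)); rewrite exprn_gt0// => /(_ isT).
rewrite !near_simpl => -[[A B] [/= [N _ AN] [N' _ BN'] /= AB]].
exists ([set n | (maxn N N' <= n)%N], [set n | (maxn N N' <= n)%N]).
  by split; exists (maxn N N').
move=> [n m]/= [nN mN].
have near1 a b : (maxn N N' <= a)%N -> (maxn N N' <= b)%N -> (a <= b)%N ->
    `|S b x - S a x| < e.
  move=> aN bN ab; rewrite -(ltr_pXn2r (n:=2)) ?nnegrE ?(ltW e0)//.
  rewrite (le_lt_trans (spectral_sum_dist _ _ x ab))//.
  have /= := AB (a, b) (conj (AN a (leq_trans (leq_maxl _ _) aN))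
    (BN' b (leq_trans (leq_maxr _ _) bN))).
  by rewrite /ball/= distrC => /(le_lt_trans (ler_norm _)).
rewrite -ball_normE/=; have [nm|mn] := leqP n m.
  by rewrite distrC; exact: near1.
by apply: near1 => //; exact: ltnW.
Qed.

Lemma spectral_integral_norm x : spectral_dom P f x ->
  (`|spectral_integral P f x| ^+ 2)%:E = (\int[smeas P x]_l (f l ^+ 2)%:E)%E.
Proof.
move=> xf; have /cvg_lim <- // := spectral_sum_norm_cvg x.
apply/esym/cvg_lim => //; apply: cvg_EFin; first by near=> n.
apply: (@cvg_comp _ _ _ (fun n => `|S n x|) (fun y : R => y ^+ 2)).
  by apply: cvg_norm; exact: spectral_integral_cvg.
exact: exprn_continuous.
Unshelve. all: by end_near. Qed.

Lemma spectral_sum_le_integral x n : spectral_dom P f x ->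
  `|S n x| <= `|spectral_integral P f x|.
Proof.
move=> xf; rewrite -ler_sqr ?nnegrE// (le_trans (spectral_sum_norm_le _ xf n))//.
by rewrite -spectral_integral_norm.
Qed.

Lemma spectral_integral_linear (a : R) x y :
  spectral_dom P f x -> spectral_dom P f y ->
  spectral_integral P f (a *: x + y) =
  a *: spectral_integral P f x + spectral_integral P f y.
Proof.
move=> xf yf; apply: norm_cvg_lim.
under eq_cvg do rewrite spectral_sum_linear//.
by apply: cvgD; [apply: cvgZr|]; exact: spectral_integral_cvg.
Qed.

End SpectralSum.

(** * Fractional powers and the spaces V^a *)

Section Powers.
Context {R : realType}.
Implicit Types (a p s c l y : R).

Lemma powR_half_sqr l a : (l `^ (a / 2)) ^+ 2 = l `^ a.
Proof. by rewrite -powR_mulrn ?powR_ge0// -powRrM divfK. Qed.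

(* [ln] is 0 on negative numbers. *)
Lemma powR_neg l a : l < 0 -> l `^ a = 1.
Proof.
by move=> l0; rewrite /powR lt_eqF// ln0 ?mulr0 ?expR0// ltW.
Qed.

Lemma powR_le1D l a s : 0 <= a -> a <= s -> l `^ a <= 1 + l `^ s.
Proof.
move=> a0 as_; have [l0|l0] := ltP l 0; first by rewrite !powR_neg// lerDl.
have [l1|l1] := leP l 1.
  rewrite (@le_trans _ _ 1) ?lerDl ?powR_ge0//.
  by rewrite (_ : 1 = 1 `^ a) ?ge0_ler_powR ?nnegrE// powR1.
by rewrite (@le_trans _ _ (l `^ s)) ?lerDr// ler_powR// ltW.
Qed.

(** Young's inequality for the product of [c] and [y^(a/p) / c] with conjugate exponents
    [1 / (1 - a/p)] and [p / a]. This is the origin of [C_1], ..., [C_4]; the factors 2 undo the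
    halving in their definition. *)
Lemma young_powR a p c y : 0 < a -> a < p -> 0 < c -> 0 <= y ->
  y `^ (a / p) <= 2 * young_fst a p c + 2 * young_snd a p c * y.
Proof.
move=> a0 ap c0 y0; have p0 := lt_trans a0 ap.
have th0 : 0 < a / p by rewrite divr_gt0.
have th1 : 0 < 1 - a / p by rewrite subr_gt0 ltr_pdivrMr// mul1r.
have := @conjugate_powR R c (y `^ (a / p) / c) (1 - a / p)^-1 (a / p)^-1.
rewrite !invr_gt0 !invrK divr_ge0 ?powR_ge0 ?(ltW c0)//.
move=> /(_ isT isT th1 th0).
rewrite subrK => /(_ erefl); rewrite mulrCA divff ?gt_eqF// mulr1.
move/le_trans; apply; rewrite lerD//.
  by rewrite /young_fst mulrA [2 * _]mulrC divfK// mulrC div1r.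
rewrite -mulrA /young_snd powRM ?powR_ge0 ?invr_ge0 ?(ltW c0)//.
rewrite -powRrM divff ?gt_eqF// powRr1// -powR_inv1 ?(ltW c0)// -powRrM mulN1r invf_div.
rewrite le_eqVlt; apply/orP; left; apply/eqP.
by field; rewrite !gt_eqF.
Qed.

Lemma young_powR_scaled (T : R) a p c l :
  0 < T -> 0 < a -> a < p -> 0 < c ->
  T `^ (a / p) * l `^ a <=
  2 * young_fst a p c + 2 * young_snd a p c * (T * l `^ p).
Proof.
move=> T0 a0 ap c0; have p0 := lt_trans a0 ap.
rewrite (_ : _ * _ = (T * l `^ p) `^ (a / p)); last first.
  by rewrite powRM ?powR_ge0 ?(ltW T0)// -powRrM mulrCA divff ?mulr1 ?gt_eqF.
by apply: young_powR => //; rewrite mulr_ge0 ?powR_ge0 ?(ltW T0).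
Qed.

Lemma young_ge0 a p c : 0 < a -> a < p -> 0 < c ->
  0 <= young_fst a p c /\ 0 <= young_snd a p c.
Proof.
move=> a0 ap c0; have p0 := lt_trans a0 ap.
rewrite /young_fst /young_snd; split; rewrite mulr_ge0 ?powR_ge0//.
  by rewrite divr_ge0// subr_ge0 ler_pdivrMr// mul1r ltW.
by rewrite divr_ge0 ?mulr_ge0// ltW.
Qed.

End Powers.

Section VSpaces.
Context {R : realType} {H : completeNormedModType R} (ip : {dot H for idfun}).
Hypothesis ip_norm : forall x : H, ip x x = `|x| ^+ 2.
Variable P : spectral_measure ip.
Implicit Types (a p s c : R) (x y : H).

Let mpow a : measurable_fun [set: R] (fun l : R => l `^ (a / 2)).
Proof. exact: measurable_powR. Qed.

Let pow_ge0 a (l : R) : 0 <= l `^ (a / 2). Proof. exact: powR_ge0. Qed.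

Lemma VspP a x : Vsp P a x <->
  (\int[smeas P x]_l (l `^ a)%:E < +oo)%E.
Proof.
rewrite /Vsp /spectral_dom/=.
by under eq_integral do rewrite powR_half_sqr.
Qed.

Lemma Vnorm_sqr a x : Vsp P a x ->
  (Vnorm P a x ^+ 2)%:E = (\int[smeas P x]_l (l `^ a)%:E)%E.
Proof.
move=> xa; rewrite /Vnorm /Lpow (spectral_integral_norm ip ip_norm)//.
by under eq_integral do rewrite powR_half_sqr.
Qed.

Lemma Vnorm_ge0 a x : 0 <= Vnorm P a x. Proof. exact: normr_ge0. Qed.

Lemma Vsp_linear a (r : R) x y : Vsp P a x -> Vsp P a y -> Vsp P a (r *: x + y).
Proof. by apply: spectral_dom_linear. Qed.

Lemma Lpow_linear a (r : R) x y : Vsp P a x -> Vsp P a y ->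
  Lpow P (a / 2) (r *: x + y) = r *: Lpow P (a / 2) x + Lpow P (a / 2) y.
Proof. by apply: spectral_integral_linear. Qed.

Lemma VspB a x y : Vsp P a x -> Vsp P a y -> Vsp P a (x - y).
Proof. by move=> xa ya; rewrite addrC -scaleN1r; exact: Vsp_linear. Qed.

Lemma LpowB a x y : Vsp P a x -> Vsp P a y ->
  Lpow P (a / 2) (x - y) = Lpow P (a / 2) x - Lpow P (a / 2) y.
Proof.
by move=> xa ya; rewrite addrC -scaleN1r Lpow_linear// scaleN1r addrC.
Qed.

Lemma Vsp0 a : Vsp P a 0.
Proof.
apply/VspP; rewrite [X in (X < _)%E](_ : _ = 0%E)//.
transitivity (\int[smeas P 0%R]_l (cst 0 l))%E; last exact: integral0.
(* Linearity with coefficient [-1] forces [P A 0 = 0], so the spectral measure of 0 is null. *)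
have mz (A : set (measurableTypeR R)) : measurable A -> smeas P (0 : H) A = 0%E.
  move=> mA; rewrite /smeas /spectral_mass.
  have := sproj_linear P mA (- 1) 0 0.
  by rewrite scaler0 addr0 scaleN1r addNr => ->; rewrite normr0 expr0n.
apply: ge0_ae_eq_integral => //.
- by apply/measurable_EFinP; exact: measurable_powR.
- by move=> l _; rewrite lee_fin powR_ge0.
- by exists setT; split => //; exact: mz.
Qed.

Lemma VspZ a (r : R) x : Vsp P a x -> Vsp P a (r *: x).
Proof. by move=> xa; rewrite -[_ *: _]addr0; apply: Vsp_linear => //; exact: Vsp0. Qed.

Lemma VnormZ a (r : R) x : Vsp P a x -> Vnorm P a (r *: x) = `|r| * Vnorm P a x.
Proof.
move=> xa; rewrite /Vnorm -normrZ; congr `|_|.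
have := Lpow_linear a 1 (0 : H) 0 (Vsp0 a) (Vsp0 a).
rewrite scaler0 addr0 scale1r => L0.
have {}L0 : Lpow P (a / 2) 0 = 0.
  by rewrite -[LHS](addrK (Lpow P (a / 2) 0)) -L0 subrr.
by rewrite -[r *: x]addr0 Lpow_linear ?L0 ?addr0//; exact: Vsp0.
Qed.

Lemma Vnorm_dist a x y : Vsp P a x -> Vsp P a y ->
  `|Vnorm P a x - Vnorm P a y| <= Vnorm P a (x - y).
Proof. by move=> xa ya; rewrite /Vnorm LpowB//; exact: ler_dist_dist. Qed.

Lemma norm_sqr_integral x : (`|x| ^+ 2)%:E = (\int[smeas P x]_l 1)%E.
Proof.
rewrite integral_cst// mul1e -[in LHS](sprojT P x).
by [].
Qed.

(** The bound [l^a <= 1 + l^s] suffices because the spectral measure has finite mass [|x|^2]. *)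
Lemma Vsp_le a s x : 0 <= a -> a <= s -> Vsp P s x -> Vsp P a x.
Proof.
move=> a0 as_ /VspP xs; apply/VspP.
apply: (@le_lt_trans _ _ (\int[smeas P x]_l (1 + (l `^ s)%:E))%E).
  apply: ge0_le_integral => //.
  - by move=> l _; rewrite lee_fin powR_ge0.
  - by apply/measurable_EFinP; exact: measurable_powR.
  - by apply: emeasurable_funD => //; apply/measurable_EFinP; exact: measurable_powR.
  - by move=> l _; rewrite -EFinD lee_fin powR_le1D.
rewrite ge0_integralD//; last 2 first.
- by move=> l _; rewrite lee_fin powR_ge0.
- by apply/measurable_EFinP; exact: measurable_powR.
by rewrite -norm_sqr_integral lte_add_pinfty// ltry.
Qed.

(** Young's inequality is applied to [(T l^p)^(a/p)] at each point [l] of the spectrum and then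
    integrated, the constant term giving [|x|^2]. [T] will be [tau^k]. *)
Lemma Vnorm_interpolation (T : R) a p c x :
  0 < T -> 0 < a -> a < p -> 0 < c -> Vsp P p x ->
  T `^ (a / p) * Vnorm P a x ^+ 2 <=
  2 * (young_fst a p c * `|x| ^+ 2 + young_snd a p c * (T * Vnorm P p x ^+ 2)).
Proof.
move=> T0 a0 ap c0 xp; have xa := Vsp_le _ _ _ (ltW a0) (ltW ap) xp.
have [F0 S0] := young_ge0 _ _ _ a0 ap c0.
have mp b : measurable_fun [set: measurableTypeR R] (fun l : R => (l `^ b)%:E).
  by apply/measurable_EFinP; exact: measurable_powR.
have pge0 b (l : R) : (0 <= (l `^ b)%:E)%E by rewrite lee_fin powR_ge0.
have VE b (k : R) : 0 <= k -> Vsp P b x ->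
    (k * Vnorm P b x ^+ 2)%:E = (\int[smeas P x]_l (k * l `^ b)%:E)%E.
  move=> k0 xb; rewrite (EFinM k) Vnorm_sqr// -ge0_integralZl_EFin//.
have NE (k : R) : (k * `|x| ^+ 2)%:E = (\int[smeas P x]_l k%:E)%E.
  by rewrite integral_cst//= EFinM -[in LHS](sprojT P x).
have S2 : 0 <= 2 * young_snd a p c * T.
  by rewrite mulr_ge0 ?(ltW T0)// mulr_ge0.
rewrite mulrDr (mulrA 2 (young_fst _ _ _)) (mulrA 2 (young_snd _ _ _)) (mulrA _ T).
rewrite -lee_fin EFinD !VE ?NE ?powR_ge0//.
rewrite -ge0_integralD//; last 3 first.
- by move=> l _; rewrite lee_fin mulr_ge0.
- by move=> l _; rewrite lee_fin mulr_ge0 ?powR_ge0// mulr_ge0 ?(ltW T0)// mulr_ge0.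
- by under eq_fun do rewrite EFinM; exact: measurable_funeM.
apply: ge0_le_integral => //.
- by move=> l _; rewrite lee_fin mulr_ge0 ?powR_ge0.
- by under eq_fun do rewrite EFinM; exact: measurable_funeM.
- apply: emeasurable_funD => //.
  by under eq_fun do rewrite EFinM; exact: measurable_funeM.
move=> l _; rewrite -EFinD lee_fin -[_ * T * _]mulrA.
exact: young_powR_scaled.
Qed.

End VSpaces.

(** * Spectral gap and control of the weaker norms by the norm of [V^s] *)

Section Coercivity.
Context {R : realType} {H : completeNormedModType R} (ip : {dot H for idfun}).
Hypothesis ip_norm : forall x : H, ip x x = `|x| ^+ 2.
Variable P : spectral_measure ip.
Implicit Types (a p s c : R) (x y : H).

(* The spectral sums of id and of its positive part agree, because the cell
   that meets the negative axis carries the coefficient 0. *)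
Let id_pos (l : R) : R := Num.max l 0.

Let mid_pos : measurable_fun [set: R] id_pos.
Proof. exact: measurable_maxr. Qed.

Let id_pos_ge0 l : 0 <= id_pos l. Proof. by rewrite le_max lexx orbT. Qed.

Let spectral_sum_id n x : spectral_sum P id n x = spectral_sum P id_pos n x.
Proof.
rewrite /spectral_sum; apply: eq_bigr => -[|i] _; first by rewrite !mul0r !scale0r.
congr (_ *: P _ x); apply/seteqP; split=> l /=; rewrite !in_itv/= => /andP[li il].
- have l0 : 0 < l by rewrite (lt_le_trans _ li)// divr_gt0 ?exprn_gt0.
  by rewrite /id_pos (max_idPl _) ?li// ltW.
- have : 0 < id_pos l by rewrite (lt_le_trans _ li)// divr_gt0 ?exprn_gt0.
  rewrite /id_pos lt_max ltxx orbF => l0.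
  by move: li il; rewrite /id_pos (max_idPl _) ?(ltW l0)// => -> ->.
Qed.

(** Positivity is given for the form of [L]; powers of [L] need it as a hole in the spectral
    measure. Halving [c] leaves the strict margin that forces the projections to vanish. *)
Lemma spectral_gap (D : set H) (L : H -> H) :
  positive_definite ip D L -> spectral_resolution D L P ->
  exists2 c, 0 < c & forall x, P `[0, c[%classic x = 0.
Proof.
move=> [c c0 Lc] [_ Ddom LP]; pose d := c / 2; have d0 : 0 < d by rewrite divr_gt0.
exists d => // x; set A : set (measurableTypeR R) := `[0, d[%classic.
have mA : measurable A by exact: measurable_itv.
set y := P A x.
(* |L y| <= (c / 2) |y| on the range of P A, which contradicts the lower bound
   c |y|^2 <= <L y, y> unless y = 0. *)
have muyA : smeas P y (~` A) = 0%E.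
  rewrite /smeas /spectral_mass /y -sprojI//; last exact: measurableC.
  by rewrite setICl sproj0 normr0 expr0n.
have yd (g : R -> R) : measurable_fun [set: measurableTypeR R] g ->
    (forall l, A l -> g l ^+ 2 <= d ^+ 2) ->
    (\int[smeas P y]_l (g l ^+ 2)%:E <= (d ^+ 2 * `|y| ^+ 2)%:E)%E.
  move=> mg gA.
  have -> : (d ^+ 2 * `|y| ^+ 2)%:E = (\int[smeas P y]_l (d ^+ 2)%:E)%E.
    by rewrite integral_cst//= EFinM -[in LHS](sprojT P y).
  apply: ae_ge0_le_integral => //.
  - by move=> l _; rewrite lee_fin sqr_ge0.
  - by apply/measurable_EFinP; exact: measurable_funX.
  - by move=> l _; rewrite lee_fin sqr_ge0.
  exists (~` A); split => //; first exact: measurableC.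
  by move=> l /= + Al; apply => _; rewrite lee_fin gA.
have yD : D y.
  rewrite Ddom /spectral_dom/=; apply: le_lt_trans (yd id _ _) _ => //; last first.
    exact: ltry.
  by move=> l; rewrite /A/= in_itv/= => /andP[l0 ld]; rewrite lerXn2r ?nnegrE// ltW.
have yid : spectral_dom P id_pos y.
  rewrite /spectral_dom/=; apply: le_lt_trans (yd id_pos _ _) _ => //; last first.
    exact: ltry.
  move=> l; rewrite /A/= in_itv/= => /andP[l0 ld].
  by rewrite /id_pos (max_idPl l0) lerXn2r ?nnegrE// ltW.
have Ly : `|L y| ^+ 2 <= d ^+ 2 * `|y| ^+ 2.
  (* [spectral_integral_norm] asks for a nonnegative integrand, which [id] is not; the sums for
     [id_pos] are the same. *)
  have -> : L y = spectral_integral P id_pos y.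
    rewrite LP// /spectral_integral; congr (lim (_ @ \oo)).
    by apply/funext => n; exact: spectral_sum_id.
  rewrite -lee_fin (spectral_integral_norm ip ip_norm)//; apply: yd => // l.
  rewrite /A/= in_itv/= => /andP[l0 ld].
  by rewrite /id_pos (max_idPl l0) lerXn2r ?nnegrE// ltW.
have := ip_le ip ip_norm (L y) y d^-1; rewrite invr_gt0 => /(_ d0).
have {Lc} := Lc y yD; rewrite invrK => h1 h2.
have h3 : d^-1 * `|L y| ^+ 2 <= d * `|y| ^+ 2.
  by rewrite mulrC ler_pdivrMr// mulrAC -expr2.
have : d * `|y| ^+ 2 <= 0 by rewrite /d in h2 h3 *; lra.
by rewrite pmulr_rle0// real_exprn_even_le0 ?normr_real//= normr_eq0 => /eqP.
Qed.

(** Off [[0, c[], 1 is at most [(1 + c^(-s)) l^s]: the summand 1 serves [l < 0], where powers equal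
    1, and [c^(-s)] serves [l >= c]. The outer 1 in the constant pays for the term [l^s] of
    [l^a <= 1 + l^s]. *)
Lemma Vnorm_coercive c a s x : 0 < c ->
  (forall x, P `[0, c[%classic x = 0) -> 0 <= a -> a <= s -> Vsp P s x ->
  Vnorm P a x ^+ 2 <= (1 + (1 + c `^ (- s))) * Vnorm P s x ^+ 2 /\
  `|x| ^+ 2 <= (1 + (1 + c `^ (- s))) * Vnorm P s x ^+ 2.
Proof.
move=> c0 Pc a0 as_ xs; have xa := Vsp_le ip P a s x a0 as_ xs.
set K := 1 + _; have K0 : 0 <= K by rewrite !addr_ge0// powR_ge0.
set A : set (measurableTypeR R) := `[0, c[%classic.
have mA : measurable A by exact: measurable_itv.
have muA : smeas P x A = 0%E.
  by rewrite /smeas /spectral_mass Pc normr0 expr0n.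
have mp b : measurable_fun [set: measurableTypeR R] (fun l : R => (l `^ b)%:E).
  by apply/measurable_EFinP; exact: measurable_powR.
have KE : (K * Vnorm P s x ^+ 2)%:E = (\int[smeas P x]_l (K * l `^ s)%:E)%E.
  rewrite (EFinM K) Vnorm_sqr// -ge0_integralZl_EFin// => l _.
  by rewrite lee_fin powR_ge0.
have one_le l : ~ A l -> 1 <= (1 + c `^ (- s)) * l `^ s.
  rewrite /A/= in_itv/= => /negP; rewrite negb_and -ltNge -leNgt => /orP[l0|cl].
    by rewrite (powR_neg l s l0) mulr1 lerDl powR_ge0.
  rewrite mulrDl mul1r -[leLHS]add0r lerD ?powR_ge0//.
  have cs0 : 0 < c `^ s by rewrite powR_gt0.
  rewrite powRN mulrC ler_pdivlMr// mul1r ge0_ler_powR ?nnegrE ?(ltW c0)//.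
    exact: le_trans as_.
  by rewrite (le_trans (ltW c0)).
have leK (g : R -> R) : measurable_fun [set: measurableTypeR R] g ->
    (forall l, 0 <= g l) -> (forall l, ~ A l -> g l <= K * l `^ s) ->
    (\int[smeas P x]_l (g l)%:E <= (K * Vnorm P s x ^+ 2)%:E)%E.
  move=> mg g0 gK; rewrite KE; apply: ae_ge0_le_integral => //.
  - by move=> l _; rewrite lee_fin.
  - exact/measurable_EFinP.
  - by move=> l _; rewrite lee_fin mulr_ge0 ?powR_ge0.
  - by under eq_fun do rewrite EFinM; exact: measurable_funeM.
  exists A; split => // l /= nle; apply: contrapT => Al; apply: nle => _.
  by rewrite lee_fin gK.
split; rewrite -lee_fin.
- rewrite Vnorm_sqr//; apply: leK => [||l Al]; first exact: measurable_powR.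
    by move=> l; exact: powR_ge0.
  rewrite (le_trans (powR_le1D l a s a0 as_))// /K mulrDl mul1r addrC lerD2l.
  exact: one_le.
- rewrite (norm_sqr_integral ip P); apply: (leK (cst 1)) => // l Al.
  rewrite (le_trans (one_le l Al))// ler_wpM2r ?powR_ge0// /K lerDr//.
Qed.

End Coercivity.

(** * Absolutely continuous functions *)

Section AbsoluteContinuity.
Context {R : realType}.
Notation mu := (@lebesgue_measure R).
Implicit Types (F G h : R -> R) (a b e t : R) (O : set R).

(* O will be an open set of small measure containing the null set where nothing
   is known about the derivative of F. *)
Let chained F a e O t := exists n (l r : nat -> R),
  [/\ forall i, (i < n)%N ->
        [/\ a <= l i, l i <= r i, r i <= t & `]l i, r i[%classic `<=` O],
      forall i j, (i < j)%N -> (j < n)%N -> r i <= l j &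
      F t - F a <= e * (t - a) + \sum_(i < n) `|F (r i) - F (l i)|].

Let chained_slope F a e O t t' : t <= t' -> F t' - F t <= e * (t' - t) ->
  chained F a e O t -> chained F a e O t'.
Proof.
move=> tt' Ftt' [n [l [r [lr rl Ft]]]]; exists n, l, r; split => //.
  by move=> i /lr[al lri rt lO]; split => //; exact: le_trans tt'.
by move: Ft Ftt'; set S := \sum_(i < n) _; lra.
Qed.

Let chained_jump F a e O t t' : 0 < e -> a <= t -> t <= t' ->
  `]t, t'[%classic `<=` O -> chained F a e O t -> chained F a e O t'.
Proof.
move=> e0 at_ tt' tO [n [l [r [lr rl Ft]]]].
exists n.+1, (fun i => if (i < n)%N then l i else t),
  (fun i => if (i < n)%N then r i else t'); split.
- move=> i _; case: ifPn => [/lr[al lri rt lO]|_]; split => //.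
  exact: le_trans tt'.
- move=> i j ij; rewrite ltnS leq_eqVlt => /orP[/eqP jn|jn].
    by rewrite jn ltnn -jn ij; rewrite jn in ij; have [] := lr i ij.
  by rewrite jn (ltn_trans ij jn) rl.
- rewrite big_ord_recr/= ltnn.
  under eq_bigr => i _ do rewrite ltn_ord.
  have : e * (t - a) <= e * (t' - a) by rewrite ler_wpM2l ?(ltW e0)// lerD2r.
  have := ler_norm (F t' - F t).
  by move: Ft; set S := \sum_(i < n) _; lra.
Qed.

(** Continuous induction. [Q] is not assumed to pass to limits, so the local step at [t] leads from
    a point just left of [t] to points just right of it, and is used at the supremum of the points
    where [Q] holds. *)
Let creeping a b (Q : R -> Prop) : a <= b -> Q a ->
  (forall t, a <= t <= b -> exists2 d, 0 < d & forall t1 t2,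
     a <= t1 -> t - d < t1 -> t1 <= t -> t <= t2 -> t2 < t + d -> t2 <= b ->
     Q t1 -> Q t2) -> Q b.
Proof.
move=> ab Qa step; pose A := [set t | a <= t <= b /\ Q t].
have Aa : A a by split => //; rewrite lexx.
have hA : has_sup A by split; [exists a|exists b => t [/andP[]]].
set T := sup A.
have aT : a <= T by apply: sup_upper_bound.
have Tb : T <= b by apply: ge_sup; [exists a|move=> t [/andP[]]].
have [|d d0 dstep] := step T; first by rewrite aT.
have [t1 [/andP[at1 t1b] Qt1] Tt1] := sup_adherent d0 hA.
have t1T : t1 <= T by apply: sup_upper_bound => //; split => //; rewrite at1.
(* Either [t2] exceeds the supremum [T], which is impossible, or it is [b]. *)
pose t2 := Num.min b (T + d / 2).
have Tt2 : T <= t2 by rewrite le_min Tb lerDl divr_ge0 ?(ltW d0).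
have Qt2 : Q t2.
  apply: (dstep t1) => //; last by rewrite ge_min lexx.
  by rewrite gt_min ltrD2l ltr_pdivrMr// ltr_pMr// ltr1n orbT.
have : t2 <= T.
  apply: sup_upper_bound => //; split => //.
  by rewrite (le_trans aT Tt2)/= ge_min lexx.
rewrite /t2 ge_min => /orP[bT|].
  by move: Qt2; rewrite /t2 (min_idPl _)// (le_trans bT)// lerDl divr_ge0 ?(ltW d0).
by rewrite gerDl leNgt divr_gt0.
Qed.

(** A derivative at the single point [t] controls only increments between points on either side of
    [t], each half by its own difference quotient; the step of [creeping] has this shape. *)
Let slope_near F t d e : is_derive t (1 : R) F d -> d < e ->
  exists2 r, 0 < r & forall t1 t2, t - r < t1 -> t1 <= t -> t <= t2 ->
    t2 < t + r -> F t2 - F t1 <= e * (t2 - t1).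
Proof.
move=> [dF <-] de.
have /cvgrPdist_lt /(_ (e - 'D_1 F t)) := dF.
rewrite subr_gt0 => /(_ de)[r /= r0 rF]; exists r => //.
have slope x : x != 0 -> `|x| < r -> x^-1 * (F (x + t) - F t) < e.
  move=> x0 xr; have := rF x; rewrite /= sub0r normrN => /(_ xr x0).
  rewrite -/('D_1 F t) distrC => /(le_lt_trans (ler_norm _)).
  rewrite ltrD2r /= /GRing.scale/= mulr1.
  by rewrite addrC.
move=> t1 t2 rt1 t1t tt2 t2r.
have h2 : F t2 - F t <= e * (t2 - t).
  move: tt2; rewrite le_eqVlt => /predU1P[->|tt2]; first by rewrite !subrr mulr0.
  have := slope (t2 - t); rewrite subrK subr_eq0 gt_eqF// => /(_ isT).
  rewrite gtr0_norm ?subr_gt0// => /(_ _)/ltW.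
  by rewrite mulrC ler_pdivrMr ?subr_gt0//; apply; rewrite ltrBlDl.
have h1 : F t - F t1 <= e * (t - t1).
  move: t1t; rewrite le_eqVlt => /predU1P[->|t1t]; first by rewrite !subrr mulr0.
  have := slope (t1 - t); rewrite subrK subr_eq0 lt_eqF// => /(_ isT).
  rewrite ltr0_norm ?subr_lt0// opprB => /(_ _)/ltW.
  rewrite -[(t1 - t)^-1]opprK -invrN opprB mulNr -mulrN opprB.
  by rewrite mulrC ler_pdivrMr ?subr_gt0//; apply; rewrite ltrBlDl -ltrBlDr.
lra.
Qed.

(* Sweeping from a to b, F grows with slope at most e except across intervals of
   O, where absolute continuity bounds the total increment. *)
Lemma absolutely_continuous_nonincreasing F a b : a <= b ->
  absolutely_continuous a b F ->
  {ae mu, forall t, a < t < b ->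
     exists2 d, is_derive t (1 : R) F d & d <= 0} ->
  F b <= F a.
Proof.
move=> ab acF [Z [mZ muZ ZF]].
apply/ler_addgt0Pr => e0 e00.
(* The slopes cost [e * (b - a)] and the jumps [e], in total at most [e0]. *)
pose e := e0 / (b - a + 2).
have ba2 : 0 < b - a + 2 by rewrite ltr_wpDl// subr_ge0.
have e_gt0 : 0 < e by rewrite divr_gt0.
have [d d0 dF] := acF e e_gt0.
have mab : measurable ([set a; b] : set (measurableTypeR R)).
  by apply: measurableU; exact: measurable_set1.
(* The endpoints join the null set, since the derivative is known only inside the interval; outer
   regularity then provides [O] with measure below the modulus [d]. *)
set N : set (measurableTypeR R) := Z `|` [set a; b].
have mZab : measurable N := measurableU _ _ mZ mab.
have muZab : mu N = 0%E.
  apply/eqP; rewrite eq_le measure_ge0 andbT.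
  rewrite (le_trans (measureU2 _ _ _))//.
  rewrite [X in (X + _)%E]muZ add0e (le_trans (measureU2 _ _ _))//;
    [|exact: measurable_set1..].
  by rewrite /= !lebesgue_measure_set1 adde0.
have [|O [oO ZO muO]] := lebesgue_regularity_outer mZab _ d0.
  by rewrite /= muZab.
have {}muO : (mu O < d%:E)%E.
  have mO : measurable (O : set (measurableTypeR R)) by exact: open_measurable.
  apply: le_lt_trans muO; rewrite -[in leLHS](setDUK ZO).
  rewrite (le_trans (measureU2 _ _ _))//; first exact: measurableD.
  by rewrite [X in (X + _)%E]muZab add0e.
have : chained F a e O b.
  apply: (creeping a b (chained F a e O)) => //.
    exists 0%N, (fun=> 0), (fun=> 0); split => //.
    by rewrite big_ord0 !subrr mulr0 addr0.
  move=> t /andP[at_ tb].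
  have [tZ|tZ] := pselect (N t).
    have [r /= r0 rO] : nbhs t O by apply: open_nbhs_nbhs; split => //; exact: ZO.
    exists r => // t1 t2 at1 rt1 t1t tt2 t2r t2b.
    apply: chained_jump => //; first exact: le_trans tt2.
    move=> x /=; rewrite in_itv/= => /andP[t1x xt2]; apply: rO.
    rewrite /ball/= ltr_distl; apply/andP; split; lra.
  have tab : a < t < b.
    rewrite !lt_neqAle at_ tb !andbT; apply/andP; split; apply/eqP => teq; apply: tZ.
      by right; left.
    by right; right.
  have [d' dF' d'0] : exists2 d, is_derive t (1 : R) F d & d <= 0.
    by apply: contrapT => h; apply: tZ; left; apply: ZF => /= /(_ tab).
  have [r r0 rF] := slope_near _ _ _ _ dF' (le_lt_trans d'0 e_gt0).
  exists r => // t1 t2 at1 rt1 t1t tt2 t2r t2b.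
  by apply: chained_slope; [exact: le_trans tt2|exact: rF].
move=> [n [l [r [lr rl Fb]]]].
have tI : trivIset setT (fun i : 'I_n => `]l i, r i[%classic : set R).
  apply/trivIsetP => i j _ _ ij; apply/seteqP; split => // x [] /=.
  rewrite !in_itv/= => /andP[lx xr] /andP[lx' xr'].
  move: ij; rewrite -(inj_eq val_inj) neq_ltn => /orP[|] ij.
    by have := rl _ _ ij (ltn_ord _); lra.
  by have := rl _ _ ij (ltn_ord _); lra.
have sum_lt : \sum_(i < n) (r i - l i) < d.
  rewrite -lte_fin; apply: le_lt_trans muO.
  rewrite -sumEFin (eq_bigr (fun i : 'I_n => mu `]l i, r i[%classic)); last first.
    move=> i _; have [_ lri _ _] := lr i (ltn_ord i).
    rewrite lebesgue_measure_itv/= lte_fin; move: lri.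
    by rewrite le_eqVlt => /predU1P[->|->]; rewrite ?ltxx ?subrr// EFinB.
  rewrite -measure_bigsetU_ord//=.
  apply: le_measure; rewrite ?inE.
  - exact: bigsetU_measurable.
  - exact: open_measurable.
  - rewrite -(bigcup_mkord n (fun i => `]l i, r i[%classic)) => x [i /= /lr[_ _ _]].
    exact.
have := dF n (fun i => l i) (fun i => r i) _ tI sum_lt.
move=> /(_ _)/ltW sF.
have {}sF : \sum_(i < n) `|F (r i) - F (l i)| <= e.
  by apply: sF => i; have [] := lr i (ltn_ord i).
have : F b - F a <= e * (b - a) + e by rewrite (le_trans Fb)// lerD2l.
have : e * (b - a) + e <= e0.
  rewrite (_ : e0 = e * (b - a + 2)); last by rewrite /e divfK// gt_eqF.
  by rewrite !mulrDr; lra.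
lra.
Qed.

Lemma absolutely_continuousB F G a b :
  absolutely_continuous a b F -> absolutely_continuous a b G ->
  absolutely_continuous a b (F \- G).
Proof.
move=> acF acG e e0; have e20 : 0 < e / 2 by rewrite divr_gt0.
have [d d0 dF] := acF _ e20; have [d' d'0 dG] := acG _ e20.
exists (Num.min d d'); first by rewrite lt_min d0.
move=> n l r lr tI; rewrite lt_min => /andP[sd sd'].
rewrite [ltRHS]splitr; apply: le_lt_trans (ltrD (dF _ _ _ lr tI sd) (dG _ _ _ lr tI sd')).
rewrite -big_split/=; apply: ler_sum => i _.
rewrite [X in `|X| <= _](_ : _ = (F (r i) - F (l i)) - (G (r i) - G (l i))).
  exact: ler_normB.
by rewrite /=; ring.
Qed.

(** * Indefinite integrals of integrable functions *)

Section IndefiniteIntegral.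
Variable g : R -> R.
Hypothesis ig : mu.-integrable setT (EFin \o g).

Let ige (A : set R) : measurable (A : set (measurableTypeR R)) ->
  mu.-integrable A (EFin \o g).
Proof. by move=> mA; exact: integrableS ig. Qed.

Let indef t := \int[mu]_(x in `]-oo, t]) g x.

Lemma indefinite_integralB (t1 t2 : R) : t1 <= t2 ->
  \int[mu]_(x in `]-oo, t2]) g x - \int[mu]_(x in `]-oo, t1]) g x =
  \int[mu]_(x in `]t1, t2[) g x.
Proof.
move=> t12; rewrite (@Rintegral_itvB _ _ _ (BRight t2) t1)//.
  by rewrite -Rintegral_itv_bndo_bndc//; exact: ige.
exact: ige.
Qed.

(** The integral of [|g|] is small on sets of small measure; this is applied to the union of the
    disjoint intervals, whose measure is the sum of their lengths. *)
Lemma absolutely_continuous_integral a b : absolutely_continuous a b indef.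
Proof.
move=> e e0; have [d [d0 dg]] := integral_normr_continuous ig e0.
exists d => // n l r lr tI sd.
pose I (i : 'I_n) : set R := `]l i, r i[%classic.
have mU : measurable (\big[setU/set0]_(i < n) I i : set (measurableTypeR R)).
  by apply: bigsetU_measurable => i _; exact: measurable_itv.
have muU : (mu (\big[setU/set0]_(i < n) I i) < d%:E)%E.
  rewrite measure_bigsetU_ord//=; last by move=> i; exact: measurable_itv.
  rewrite (eq_bigr (fun i => (r i - l i)%:E)) ?sumEFin ?lte_fin// => i _.
  have [_ lri _] := lr i.
  rewrite lebesgue_measure_itv/= lte_fin; move: lri.
  by rewrite le_eqVlt => /predU1P[->|->]; rewrite ?ltxx ?subrr// EFinB.
apply: le_lt_trans (dg _ mU muU).
have ing (A : set R) : measurable (A : set (measurableTypeR R)) ->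
    mu.-integrable A (fun x => `|g x|%:E).
  by move=> mA; apply: integrable_norm; exact: ige.
rewrite /Rintegral ge0_integral_bigsetU//=; last 4 first.
- by move=> i; exact: measurable_itv.
- exact: index_enum_uniq.
- by apply: sub_trivIset tI.
- exact: measurable_int (ing _ mU).
rewrite -sum_fine//; last first.
  move=> i _; apply: integrable_fin_num; first exact: measurable_itv.
  exact: (ing _ (measurable_itv _)).
apply: ler_sum => i _; have [_ lri _] := lr i.
rewrite indefinite_integralB//.
by apply: le_normr_Rintegral => //; exact: ige.
Qed.

Lemma indefinite_integral_derive :
  {ae mu, forall t, is_derive t (1 : R) indef (g t)}.
Proof.
have locg : locally_integrable setT g.
  split => //; first by move/measurable_int : ig => /measurable_EFinP.
    exact: openT.
  move=> K _ cK; have mK : measurable (K : set (measurableTypeR R)).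
    exact: compact_measurable.
  by have /integrableP[_] := ige _ mK.
have := FTC1Ny (fun y => ige `]-oo, y]%classic (measurable_itv _)) locg.
apply: filterS; first exact: (ae_filter_ringOfSetsType mu).
move=> t [dt <-]; rewrite derive1E; exact: derivableP.
Qed.

End IndefiniteIntegral.

(** Monotonicity of [F] minus the indefinite integral of [h], extended by 0 to the whole line, gives
    the one inequality needed from the fundamental theorem of calculus. *)
Lemma absolutely_continuous_le_integral F h a b : a < b ->
  absolutely_continuous a b F ->
  mu.-integrable `]a, b[ (EFin \o h) ->
  {ae mu, forall t, a < t < b ->
     exists2 d, is_derive t (1 : R) F d & d <= h t} ->
  F b - F a <= \int[mu]_(t in `]a, b[) h t.
Proof.
move=> ab acF ih dF; pose g := h \_ `]a, b[%classic.
have ig : mu.-integrable setT (EFin \o g).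
  by rewrite -restrict_EFin; apply/integrable_restrict => //=; rewrite setTI.
pose G t := \int[mu]_(x in `]-oo, t]) g x.
have -> : \int[mu]_(t in `]a, b[) h t = G b - G a.
  rewrite /G indefinite_integralB ?ltW//; apply: eq_Rintegral => t tab.
  by rewrite /g patchE tab.
suff : (F \- G) b <= (F \- G) a by rewrite /=; lra.
apply: absolutely_continuous_nonincreasing (ltW ab) _ _.
  by apply: absolutely_continuousB => //; exact: absolutely_continuous_integral.
have := indefinite_integral_derive _ ig; move: dF.
apply: filterS2; first exact: (ae_filter_ringOfSetsType mu).
move=> t dF dG tab.
have [d dFt dh] := dF tab.
exists (d - g t).
  exact: is_deriveB.
by rewrite subr_le0 /g patchE mem_set//= in_itv/=.
Qed.

End AbsoluteContinuity.

(** * Functions in H^1 with values in V^s *)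

Section BochnerH1.
Context {R : realType} {H : completeNormedModType R} (ip : {dot H for idfun}).
Hypothesis ip_norm : forall x : H, ip x x = `|x| ^+ 2.
Variable P : spectral_measure ip.
Notation mu := (@lebesgue_measure R).
Implicit Types (a b s p q c C : R) (x y z : H) (nu : H -> R).

Lemma integrableZl_EFin (A : set R) (k : R) (g : R -> R) :
  measurable (A : set (measurableTypeR R)) -> mu.-integrable A (EFin \o g) ->
  mu.-integrable A (EFin \o (fun t => k * g t)).
Proof. by move=> mA ig; exact: (integrableZl _ k ig). Qed.

Lemma integrableD_EFin (A : set R) (g h : R -> R) :
  measurable (A : set (measurableTypeR R)) -> mu.-integrable A (EFin \o g) ->
  mu.-integrable A (EFin \o h) -> mu.-integrable A (EFin \o (fun t => g t + h t)).
Proof. by move=> mA ig ih; exact: (integrableD _ ig ih). Qed.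

Lemma integrable_cst_itv (a b k : R) : mu.-integrable `]a, b[ (EFin \o cst k).
Proof.
apply: measurable_bounded_integrable => //; last exact: bounded_cst.
by rewrite /= lebesgue_measure_itv/=; case: ifPn => // _; rewrite -EFinB ltry.
Qed.

Lemma ip_cauchy_schwarz x y : `|ip x y| <= `|x| * `|y|.
Proof.
suff CS u v : ip u v <= `|u| * `|v|.
  rewrite ler_norml CS andbT lerNl -(normrN x).
  by rewrite -[X in X <= _]mulN1r -ipZl scaleN1r CS.
have [->|u0] := eqVneq u 0.
  by rewrite -(subrr 0) ipBl !subrr normr0 mul0r.
have [->|v0] := eqVneq v 0.
  by rewrite -(subrr 0) ipBr !subrr normr0 mulr0.
have q0 : 0 < `|v| / `|u| by rewrite divr_gt0// normr_gt0.
apply: le_trans (ip_le ip ip_norm u v _ q0) _.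
rewrite le_eqVlt; apply/orP; left; apply/eqP.
by field; rewrite !normr_eq0 u0 v0.
Qed.

Section Measurability.
Variables (s C a b : R) (nu : H -> R) (f : R -> H).
Hypothesis nu_lip : forall x y, Vsp P s x -> Vsp P s y ->
  `|nu x - nu y| <= C * Vnorm P s (x - y).

Lemma measurable_simple_comp (g : R -> H) : simple_in (Vsp P s) g ->
  measurable_fun [set: measurableTypeR R] (nu \o g).
Proof.
move=> [fg _ mg] _ Y mY; rewrite setTI.
rewrite (_ : _ @^-1` _ =
    \bigcup_(x in range g `&` [set x | Y (nu x)]) (g @^-1` [set x])).
  apply: fin_bigcup_measurable => //; exact: finite_setIl.
apply/seteqP; split=> [t /= Yt|t [x [_ /= Yx] /= gx]]; last by rewrite gx.
by exists (g t) => //; split => //; exists t.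
Qed.

(** A functional that is Lipschitz for the norm of [V^s] carries the simple approximations to a
    pointwise convergent sequence. It is used with the norms of [V^c] and [H] and with pairings. *)
Lemma measurable_strongly_measurable_comp :
  strongly_measurable P s a b f -> (forall t, a < t < b -> Vsp P s (f t)) ->
  measurable_fun (`]a, b[ : set (measurableTypeR R)) (nu \o f).
Proof.
move=> [g gs gf] fs.
apply: (@measurable_fun_cvg _ _ _ _ (fun n => nu \o g n)) => [n|t tab].
  by apply: measurable_funTS; exact: measurable_simple_comp.
have {}tab : a < t < b by move: tab; rewrite /= in_itv.
have gV n : Vsp P s (g n t) by have [_ + _] := gs n; apply; exists t.
apply/cvgrPdist_le => e e0.
have C0 : 0 < `|C| + 1 by rewrite ltr_wpDl.
have := gf t tab => /cvgrPdist_lt /(_ (e / (`|C| + 1))).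
rewrite divr_gt0// => /(_ isT); apply: filterS => n.
rewrite sub0r normrN ger0_norm ?Vnorm_ge0// ltr_pdivlMr// => /ltW ge.
rewrite distrC (le_trans (nu_lip _ _ (gV n) (fs t tab)))// (le_trans _ ge)//.
rewrite mulrC ler_wpM2l ?Vnorm_ge0//.
by rewrite (le_trans (ler_norm C))// lerDl.
Qed.

End Measurability.

Section Integrability.
Variables (s K a b : R) (w w' : R -> H).
Hypothesis K0 : 0 <= K.
Hypothesis coercive : forall c x, 0 <= c -> c <= s -> Vsp P s x ->
  Vnorm P c x ^+ 2 <= K * Vnorm P s x ^+ 2 /\
  `|x| ^+ 2 <= K * Vnorm P s x ^+ 2.
Hypothesis wH1 : is_H1 P s a b w w'.

Let sqrt_le (u v : R) : 0 <= u -> 0 <= v -> u ^+ 2 <= K * v ^+ 2 ->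
  u <= Num.sqrt K * v.
Proof.
move=> u0 v0 uv; rewrite -(ler_pXn2r (n:=2)) ?nnegrE ?mulr_ge0 ?sqrtr_ge0//.
by rewrite exprMn sqr_sqrtr.
Qed.

Let w's t : a < t < b -> Vsp P s (w' t). Proof. by have [_ + _ _ _] := wH1; exact. Qed.

Lemma Vnorm_le_sqrt c x : 0 <= c -> c <= s -> Vsp P s x ->
  Vnorm P c x <= Num.sqrt K * Vnorm P s x.
Proof.
by move=> c0 cs xs; apply: sqrt_le; rewrite ?Vnorm_ge0//; have [] := coercive c x c0 cs xs.
Qed.

Lemma norm_le_sqrt c x : 0 <= c -> c <= s -> Vsp P s x ->
  `|x| <= Num.sqrt K * Vnorm P s x.
Proof.
by move=> c0 cs xs; apply: sqrt_le; rewrite ?Vnorm_ge0//; have [] := coercive c x c0 cs xs.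
Qed.

Lemma measurable_Vnorm c : 0 <= c -> c <= s ->
  measurable_fun (`]a, b[ : set (measurableTypeR R)) (fun t => Vnorm P c (w' t)).
Proof.
move=> c0 cs; have [_ _ mw _ _] := wH1.
apply: (measurable_strongly_measurable_comp s (Num.sqrt K) a b (Vnorm P c) w') => //.
move=> x y xs ys; have xys := VspB ip ip_norm P s x y xs ys.
have xc := Vsp_le ip P c s x c0 cs xs; have yc := Vsp_le ip P c s y c0 cs ys.
by rewrite (le_trans (Vnorm_dist ip ip_norm P c x y xc yc))// Vnorm_le_sqrt.
Qed.

Lemma measurable_norm : 0 <= s ->
  measurable_fun (`]a, b[ : set (measurableTypeR R)) (fun t => `|w' t|).
Proof.
move=> s0; have [_ _ mw _ _] := wH1.
apply: (measurable_strongly_measurable_comp s (Num.sqrt K) a b (fun x => `|x|) w') => //.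
move=> x y xs ys; have xys := VspB ip ip_norm P s x y xs ys.
by rewrite (le_trans (ler_dist_dist _ _))// (norm_le_sqrt s).
Qed.

Lemma measurable_ip z : 0 <= s ->
  measurable_fun (`]a, b[ : set (measurableTypeR R)) (fun t => ip (w' t) z).
Proof.
move=> s0; have [_ _ mw _ _] := wH1.
apply: (measurable_strongly_measurable_comp s (`|z| * Num.sqrt K) a b (ip^~ z) w') => //.
move=> x y xs ys; have xys := VspB ip ip_norm P s x y xs ys.
rewrite -ipBl (le_trans (ip_cauchy_schwarz _ _))// mulrC -mulrA ler_wpM2l//.
by rewrite (norm_le_sqrt s).
Qed.

Let integrable_le_Vnorm (g : R -> R) :
  measurable_fun (`]a, b[ : set (measurableTypeR R)) g ->
  (forall t, a < t < b -> 0 <= g t <= K * Vnorm P s (w' t) ^+ 2) -> 0 <= s ->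
  mu.-integrable `]a, b[ (EFin \o g).
Proof.
move=> mg gK s0; have [_ _ _ fin _] := wH1.
have mV : measurable_fun (`]a, b[ : set (measurableTypeR R))
    (fun t => Vnorm P s (w' t) ^+ 2).
  by apply: measurable_funX; exact: measurable_Vnorm.
have iV0 : mu.-integrable `]a, b[ (EFin \o (fun t => Vnorm P s (w' t) ^+ 2)).
  apply/integrableP; split; first exact/measurable_EFinP.
  apply: le_lt_trans fin; apply: ge0_le_integral => //.
  - by apply: measurableT_comp => //; exact/measurable_EFinP.
  - exact/measurable_EFinP.
  - by move=> t _; rewrite /= ger0_norm// sqr_ge0.
have iV := integrableZl_EFin _ K _ (measurable_itv _) iV0.
apply: le_integrable iV => //; first exact/measurable_EFinP.
move=> t /=; rewrite in_itv/= => tab; have /andP[g0 gt] := gK t tab.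
by rewrite lee_fin !ger0_norm// (le_trans g0).
Qed.

Lemma integrable_Vnorm_sqr c : 0 <= c -> c <= s ->
  mu.-integrable `]a, b[ (EFin \o (fun t => Vnorm P c (w' t) ^+ 2)).
Proof.
move=> c0 cs; apply: integrable_le_Vnorm; last exact: le_trans cs.
- by apply: measurable_funX; exact: measurable_Vnorm.
- by move=> t /w's ts; rewrite sqr_ge0/=; have [] := coercive c _ c0 cs ts.
Qed.

Lemma integrable_norm_sqr : 0 <= s ->
  mu.-integrable `]a, b[ (EFin \o (fun t => `|w' t| ^+ 2)).
Proof.
move=> s0; apply: integrable_le_Vnorm => //.
- by apply: measurable_funX; exact: measurable_norm.
- by move=> t /w's ts; rewrite sqr_ge0/=; have [] := coercive 0 _ (lexx _) s0 ts.
Qed.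

Lemma integrable_ip z : 0 <= s ->
  mu.-integrable `]a, b[ (EFin \o (fun t => ip (w' t) z)).
Proof.
move=> s0.
have := integrableD_EFin _ _ _ (measurable_itv _) (integrable_norm_sqr s0)
  (integrable_cst_itv a b (`|z| ^+ 2)).
apply: le_integrable => //; first by apply/measurable_EFinP; exact: measurable_ip.
move=> t _; rewrite /= lee_fin [leRHS]ger0_norm ?addr_ge0 ?sqr_ge0//.
rewrite (le_trans (ip_cauchy_schwarz _ _))//.
have := sqr_ge0 (`|w' t| - `|z|); have : 0 <= `|w' t| * `|z| by rewrite mulr_ge0.
by move=> ? ?; nra.
Qed.

(** With [d = w t - w a], symmetry gives [|L n d|^2 = \int <L n w', L n d>]. Integration in time
    costs a factor [b - a], interpolation treats [w'], and the limit in [n] recovers the norm of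
    [V^c]. *)
Lemma H1_displacement (T : R) c p q t : a < b -> a <= t <= b ->
  0 < T -> 0 < c -> c < p -> p <= s -> 0 < q ->
  T `^ (c / p) * Vnorm P c (w t - w a) ^+ 2 <=
  (b - a) * (2 * (young_fst c p q * sq_L2norm (fun x : H => `|x|) a b w' +
                  young_snd c p q * (T * sq_L2norm (Vnorm P p) a b w'))).
Proof.
move=> ab /andP[at_ tb] T0 c0 cp ps q0.
have p0 := lt_trans c0 cp; have s0 : 0 <= s by rewrite (le_trans _ ps)// ltW.
have cs : c <= s := le_trans (ltW cp) ps.
have ba : 0 < b - a by rewrite subr_gt0.
have [ws _ _ _ wE] := wH1.
have mpow : measurable_fun [set: R] (fun l : R => l `^ (c / 2)) by exact: measurable_powR.
have pow0 (l : R) : 0 <= l `^ (c / 2) by exact: powR_ge0.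
have wts : Vsp P s (w t) by apply: ws; rewrite at_.
have was : Vsp P s (w a) by apply: ws; rewrite lexx ltW.
have ds := VspB ip ip_norm P s _ _ wts was.
have dc := Vsp_le ip P c s _ (ltW c0) cs ds.
set d := w t - w a in ds dc *; pose Th := T `^ (c / p).
have Th0 : 0 < Th by exact: powR_gt0.
set F := young_fst c p q; set S := young_snd c p q.
have [F0 S0] : 0 <= F /\ 0 <= S by exact: young_ge0.
pose k r := 2 * (F * `|w' r| ^+ 2 + S * (T * Vnorm P p (w' r) ^+ 2)).
have iN := integrable_norm_sqr s0.
have iV := integrable_Vnorm_sqr p (ltW p0) ps.
have iFN : mu.-integrable `]a, b[ (EFin \o (fun r => F * `|w' r| ^+ 2)).
  exact: integrableZl_EFin.
have iTV : mu.-integrable `]a, b[ (EFin \o (fun r => T * Vnorm P p (w' r) ^+ 2)).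
  exact: integrableZl_EFin.
have iSTV : mu.-integrable `]a, b[ (EFin \o (fun r => S * (T * Vnorm P p (w' r) ^+ 2))).
  exact: integrableZl_EFin.
have iFS : mu.-integrable `]a, b[
    (EFin \o (fun r => F * `|w' r| ^+ 2 + S * (T * Vnorm P p (w' r) ^+ 2))).
  exact: integrableD_EFin.
have ik : mu.-integrable `]a, b[ (EFin \o k) by exact: integrableZl_EFin.
have kE : \int[mu]_(r in `]a, b[) k r = 2 * (F * sq_L2norm (fun x : H => `|x|) a b w' +
    S * (T * sq_L2norm (Vnorm P p) a b w')).
  by rewrite /k RintegralZl// RintegralD// !RintegralZl.
have k0 r : 0 <= k r.
  by rewrite /k mulr_ge0// addr_ge0// mulr_ge0 ?sqr_ge0// mulr_ge0 ?sqr_ge0// ltW.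
rewrite -kE -/Th; set I := \int[mu]_(r in _) k r.
pose L n := spectral_sum P (fun l => l `^ (c / 2)) n.
suff bound n : `|L n d| ^+ 2 <= (b - a) / Th * I.
  rewrite mulrC -ler_pdivlMr// mulrAC.
  rewrite -lee_fin Vnorm_sqr//.
  have := spectral_sum_norm_cvg ip ip_norm P _ mpow pow0 d.
  under eq_integral do rewrite powR_half_sqr.
  move/cvg_lim => <- //; apply: lime_le.
    by apply/cvg_ex; eexists; exact: spectral_sum_norm_cvg.
  by apply: nearW => n; rewrite lee_fin.
set e := L n d.
(* With weight [b - a], the last term integrates over []a, b[] to [|e|^2 / 2], which the left-hand
   side [|e|^2] absorbs. *)
have pt r : a < r < b ->
    ip (w' r) (L n e) <= (b - a) / Th / 2 * k r + `|e| ^+ 2 / (b - a) / 2.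
  move=> rab; rewrite -spectral_sum_sym//.
  apply: le_trans (ip_le ip ip_norm _ _ _ ba) _; rewrite mulrDl lerD2r.
  rewrite (_ : (b - a) / Th / 2 * k r = (b - a) * (k r / Th) / 2); last first.
    by field; rewrite gt_eqF.
  rewrite ler_pM2r ?invr_gt0// ler_pM2l// ler_pdivlMr//.
  have rs := w's r rab.
  have rc := Vsp_le ip P c s _ (ltW c0) cs rs.
  have rp := Vsp_le ip P p s _ (ltW p0) ps rs.
  have := Vnorm_interpolation ip ip_norm P T c p q _ T0 c0 cp q0 rp.
  apply: le_trans; rewrite mulrC ler_pM2l//.
  by rewrite lerXn2r ?nnegrE ?Vnorm_ge0//; exact: spectral_sum_le_integral.
pose m r := (b - a) / Th / 2 * k r + `|e| ^+ 2 / (b - a) / 2.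
have im : mu.-integrable `]a, b[ (EFin \o m).
  have i1 := integrableZl_EFin _ ((b - a) / Th / 2) _ (measurable_itv _) ik.
  by apply: integrableD_EFin => //; exact: integrable_cst_itv.
have m0 r : 0 <= m r.
  apply: addr_ge0; last by rewrite !divr_ge0 ?sqr_ge0 ?(ltW ba).
  by apply: mulr_ge0 => //; rewrite !divr_ge0 ?(ltW ba) ?(ltW Th0).
have sub : `]a, t[ `<=` `]a, b[ by apply: subset_itvl; rewrite bnd_simp.
(* As [m] is nonnegative, the integral may be extended from [t] to [b], which makes the bound
   uniform in [t]. *)
have ipm : \int[mu]_(r in `]a, t[) ip (w' r) (L n e) <= \int[mu]_(r in `]a, b[) m r.
  apply: (@le_trans _ _ (\int[mu]_(r in `]a, t[) m r)).
    apply: le_Rintegral => //.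
    - by apply: integrableS (integrable_ip (L n e) s0).
    - by apply: integrableS im.
    - by move=> r /sub; rewrite /= in_itv/=; exact: pt.
  have fin A : A `<=` `]a, b[ -> measurable (A : set (measurableTypeR R)) ->
      (\int[mu]_(r in A) (m r)%:E)%E \is a fin_num.
    by move=> Aab mA; apply: integrable_fin_num => //; exact: integrableS im.
  rewrite /Rintegral fine_le ?fin//; apply: ge0_subset_integral => //.
  - exact: (measurable_int _ im).
  - by move=> r _; rewrite lee_fin.
have : \int[mu]_(r in `]a, b[) m r = (b - a) / Th / 2 * I + `|e| ^+ 2 / 2.
  rewrite /m RintegralD//; last 2 first.
  - exact: integrableZl_EFin.
  - exact: integrable_cst_itv.
  rewrite RintegralZl// Rintegral_cst//= lebesgue_measure_itv/= lte_fin ab/=.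
  by congr (_ + _); field; rewrite gt_eqF.
move=> mE; rewrite mE in ipm.
rewrite -/e in ipm |- *.
suff : `|e| ^+ 2 = \int[mu]_(r in `]a, t[) ip (w' r) (L n e).
  by move: ipm; set X := \int[mu]_(r in `]a, t[) _; set Y := _ / Th; lra.
rewrite -ip_norm {1}/e /L spectral_sum_sym// /d ipBl.
by rewrite wE ?at_//; ring.
Qed.

End Integrability.
End BochnerH1.

(** * The Lagrange basis *)

Section LagrangeBasis.
Context {R : realType}.
Notation mu := (@lebesgue_measure R).
Implicit Types (k i j : nat) (tau s : R).

Let lagrange_poly k i : {poly R} :=
  \prod_(0 <= m < k | m != i) ((m%:R - i%:R)^-1 *: ('X + m%:R%:P)).

Let lagrange_polyE k tau i s :
  lagrange_basis k tau i s = (lagrange_poly k i).[s / tau].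
Proof.
rewrite /lagrange_basis /lagrange_poly horner_prod; apply: eq_bigr => m _.
by rewrite !hornerE mulrC [_ + m%:R]addrC.
Qed.

Let size_lagrange_poly k i : (i < k)%N -> (size (lagrange_poly k i) <= k)%N.
Proof.
move=> ik; have size_prod (r : seq nat) :
    (size (\prod_(m <- r | m != i) ((m%:R - i%:R)^-1 *: ('X + m%:R%:P)) : {poly R})%R
      <= (count (predC1 i) r).+1)%N.
  elim: r => [|m r IH]; first by rewrite big_nil size_poly1.
  rewrite big_cons /=; case: ifPn => // _; rewrite add1n.
  apply: leq_trans (size_polyMleq _ _) _.
  have h : (size ((m%:R - i%:R)^-1 *: ('X + m%:R%:P) : {poly R})%R <= 2)%N.
    by rewrite (leq_trans (size_scale_leq _ _))// size_XaddC.
  rewrite -subn1 leq_subLR (leq_trans (leq_add h IH))//.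
apply: leq_trans (size_prod _) _.
have := count_predC (pred1 i) (index_iota 0 k).
rewrite count_uniq_mem ?iota_uniq// mem_index_iota ik size_iota subn0 => kE.
by rewrite -[leqRHS]kE.
Qed.

(** As a polynomial in [s / tau], the sum minus 1 has size at most [k] and vanishes at the [k]
    points [0, -1, ..., 1 - k], the past times in units of [tau]. *)
Lemma sum_lagrange_basis k tau s : (0 < k)%N -> 0 < tau ->
  \sum_(0 <= i < k) lagrange_basis k tau i s = 1.
Proof.
move=> k0 tau0; pose p : {poly R} := \sum_(0 <= i < k) lagrange_poly k i - 1.
suff p0 : p = 0.
  have : p.[s / tau] = 0 by rewrite p0 horner0.
  rewrite /p hornerD hornerN hornerC horner_sum => /eqP; rewrite subr_eq0 => /eqP <-.
  by apply: eq_bigr => i _; rewrite lagrange_polyE.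
apply/eqP; apply: contraT => p0.
have vanish (j : nat) : (j < k)%N -> root p (- j%:R).
  move=> jk; rewrite /root /p hornerD hornerN hornerC horner_sum.
  rewrite (bigD1_seq j) ?mem_index_iota ?iota_uniq//= big1_seq ?addr0.
    rewrite /lagrange_poly horner_prod big1_seq ?subrr// => m /andP[mj _].
    by rewrite !hornerE addrC mulVf// addrC subr_eq0 eqr_nat.
  move=> i /andP[ij _]; rewrite /lagrange_poly horner_prod.
  rewrite (big_rem j) ?mem_index_iota//= eq_sym ij.
  by rewrite !hornerE addNr mulr0 mul0r.
have /= := @max_poly_roots _ p [seq - (m%:R : R) | m <- index_iota 0 k] p0.
rewrite size_map size_iota subn0 ltnNge.
have -> : (size p <= k)%N.
  rewrite (leq_trans (size_polyD _ _))// size_polyN size_poly1 geq_max k0 andbT.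
  rewrite (leq_trans (size_sum _ _ _))//.
  by apply/bigmax_leqP_seq => i; rewrite mem_index_iota => ik _; exact: size_lagrange_poly.
move=> /= h; apply: h.
  by apply/allP => _ /mapP[m + ->]; rewrite mem_index_iota; exact: vanish.
by rewrite map_inj_uniq ?iota_uniq// => m n /oppr_inj/eqP; rewrite eqr_nat => /eqP.
Qed.

(** Summation by parts up to any [K] leaves a boundary term [a K * M K], which vanishes at [K = k]
    because the basis sums to 1. The shift in [M] reserves index 0 for the current state. *)
Lemma abel_lagrange k tau s (M : nat -> R) : (0 < k)%N -> 0 < tau ->
  \sum_(0 <= i < k) lagrange_basis k tau i s * M i.+1 - M 0%N =
  \sum_(0 <= j < k) (1 - \sum_(0 <= i < j) lagrange_basis k tau i s) *
    (M j.+1 - M j).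
Proof.
move=> k0 tau0; set l := lagrange_basis k tau ^~ s.
pose a j := 1 - \sum_(0 <= i < j) l i.
have abel K : \sum_(0 <= i < K) l i * M i.+1 - M 0%N =
    \sum_(0 <= j < K) a j * (M j.+1 - M j) - a K * M K.
  elim: K => [|K IH]; first by rewrite /a !big_geq// subr0 mul1r.
  rewrite !big_nat_recr//= addrAC IH /a big_nat_recr//=; ring.
by rewrite abel /a sum_lagrange_basis// subrr mul0r subr0.
Qed.

Lemma continuous_lagrange_basis k tau i a :
  continuous (fun t => lagrange_basis k tau i (t - a)).
Proof.
move=> t; rewrite (_ : (fun t => _) = (fun t => (lagrange_poly k i).[(t - a) / tau])).
  apply: (@continuous_comp _ _ _ (fun t : R => (t - a) / tau)
    (horner (lagrange_poly k i))); last exact: continuous_horner.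
  by apply: cvgMl; apply: cvgB => //; exact: cvg_cst.
by apply/funext => u; rewrite lagrange_polyE.
Qed.

Lemma continuous_lagrange_tail k tau j a :
  continuous (fun t => 1 - \sum_(0 <= i < j) lagrange_basis k tau i (t - a)).
Proof.
move=> t; apply: cvgB; first exact: cvg_cst.
elim: j => [|j IH].
  by under eq_fun do rewrite big_geq//; rewrite big_geq//; exact: cvg_cst.
under eq_fun do rewrite big_nat_recr//=; rewrite big_nat_recr//=.
by apply: cvgD => //; exact: continuous_lagrange_basis.
Qed.

End LagrangeBasis.

(** * Duality between [V^a] and [V^-a] *)

Section Duality.
Context {R : realType} {H : completeNormedModType R} (ip : {dot H for idfun}).
Hypothesis ip_norm : forall x : H, ip x x = `|x| ^+ 2.
Variable P : spectral_measure ip.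
Implicit Types (x y v : H).

(** By normalising [v]. The bound contained in [Vdual] is needed twice: when [v] has zero norm, and
    to bound the set of values, as [sup] of an unbounded set is a default value. *)
Lemma Vdual_le (a : R) (phi : H -> R) v : Vdual P a phi -> Vsp P a v ->
  `|phi v| <= Vdual_norm P a phi * Vnorm P a v.
Proof.
move=> [lin [M bd]] va; have [v0|v0] := eqVneq (Vnorm P a v) 0.
  by have := bd v va; rewrite v0 !mulr0.
have nv0 : 0 < Vnorm P a v by rewrite lt_neqAle eq_sym v0 Vnorm_ge0.
have z0 := Vsp0 ip P a.
have phi0 : phi 0 = 0.
  have := lin 1 0 0 z0 z0; rewrite scaler0 addr0 mul1r => phi0.
  by rewrite -[LHS](addrK (phi 0)) -phi0 subrr.
set v' := (Vnorm P a v)^-1 *: v.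
have v'a : Vsp P a v' by exact: VspZ.
have v'1 : Vnorm P a v' = 1.
  by rewrite VnormZ// ger0_norm ?invr_ge0 ?Vnorm_ge0// mulVf.
rewrite -ler_pdivrMr//; have -> : `|phi v| / Vnorm P a v = `|phi v'|.
  rewrite /v' -[_ *: v]addr0 lin// phi0 addr0 normrM.
  by rewrite (@ger0_norm _ (_^-1)) ?invr_ge0 ?Vnorm_ge0// mulrC.
rewrite /Vdual_norm; apply: sup_upper_bound; last by exists v' => //; split => //; rewrite v'1.
split; first by exists `|phi v'|, v' => //; split => //; rewrite v'1.
exists `|M| => _ [y [ya y1] <-]; rewrite (le_trans (bd y ya))//.
rewrite (le_trans (ler_norm _))// normrM (ger0_norm (Vnorm_ge0 ip P a y)).
by rewrite -[leRHS]mulr1 ler_wpM2l.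
Qed.

Lemma lipschitz_pairing (beta gamma CL : R) (N : H -> H -> R) x y v :
  lipschitz_nonlinearity P beta gamma CL N ->
  Vsp P gamma x -> Vsp P gamma y -> Vsp P beta v ->
  `|N x v - N y v| <= CL * Vnorm P gamma (x - y) * Vnorm P beta v.
Proof.
move=> [dualN lipN] xg yg vb.
have dual : Vdual P beta (fun z => N x z - N y z).
  have [linx [M bx]] := dualN x xg; have [liny [M' by']] := dualN y yg.
  split=> [c z z' zb z'b|]; first by rewrite linx// liny//; ring.
  exists (M + M') => z zb; rewrite mulrDl (le_trans (ler_normB _ _))//.
  by rewrite lerD ?bx ?by'.
apply: le_trans (Vdual_le _ _ _ dual vb) _.
by rewrite ler_wpM2r ?Vnorm_ge0// lipN.
Qed.

Lemma Vnorm_distC (a : R) x y : Vsp P a x -> Vsp P a y ->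
  Vnorm P a (x - y) = Vnorm P a (y - x).
Proof. by move=> xa ya; rewrite /Vnorm !LpowB// distrC. Qed.

End Duality.

(** * Real inequalities, telescoping and integrals of sums *)

Section RealLemmas.
Context {R : realType}.
Notation mu := (@lebesgue_measure R).

(** [a] will be a coefficient, [d] an increment in [V^gamma], [y] the [V^beta] norm of [w']. With
    Young weight [kap * thb], the relation [thg * thb = tau^2] turns [d^2 / thb] into at most
    [2 Q / tau]. *)
Lemma young_product (a d y kap tau thg thb Q Y : R) :
  0 <= d -> 0 <= y -> 0 < kap -> 0 < tau -> 0 < thg -> 0 < thb ->
  thg * thb = tau ^+ 2 ->
  thg * d ^+ 2 <= tau * (2 * Q) -> thb * y ^+ 2 <= 2 * Y ->
  `|a| * (d * y) <= a ^+ 2 * (Q / (kap * tau)) + kap * Y.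
Proof.
move=> d0 y0 kap0 tau0 thg0 thb0 thE dQ yY.
have kt0 : 0 < kap * thb by rewrite mulr_gt0.
have amgm : `|a| * (d * y) <= (a ^+ 2 * d ^+ 2 / (kap * thb) + kap * (thb * y ^+ 2)) / 2.
  rewrite -subr_ge0 (_ : _ - _ =
      (`|a| * d - kap * thb * y) ^+ 2 / (kap * thb) / 2).
    by rewrite !divr_ge0 ?sqr_ge0// ltW.
  have a2 : a ^+ 2 = `|a| ^+ 2 by rewrite real_normK ?num_real.
  by rewrite a2; field; rewrite !gt_eqF.
have dQ' : d ^+ 2 / (kap * thb) <= 2 * Q / (kap * tau).
  rewrite ler_pdivrMr// mulrAC ler_pdivlMr ?mulr_gt0//.
  rewrite -(ler_pM2r (mulr_gt0 thg0 tau0)).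
  have := ler_wpM2r (mulr_ge0 (ltW kap0) (sqr_ge0 tau)) dQ.
  by move: thE => /(congr1 (fun z => 2 * Q * kap * z * tau)); lra.
have := ler_wpM2l (sqr_ge0 a) dQ'; have := ler_wpM2l (ltW kap0) yY.
by move: amgm; rewrite -!mulrA; lra.
Qed.

(** As [S j - S j.+1 = c j], moving the window by one step lowers the weight of each past [X j] by
    exactly its contribution [c j * X j] to the energy increment. Hence the tail sums in the
    modified energy. *)
Lemma telescoping_tail (k : nat) (c X : nat -> R) :
  let S j := \sum_(j <= i < k) c i in (0 < k)%N ->
  \sum_(1 <= j < k) S j * X j.-1 - \sum_(1 <= j < k) S j * X j =
  S 1%N * X 0%N - \sum_(1 <= j < k) c j * X j.
Proof.
move=> S; case: k @S => // k S _.
have SS j : (j < k.+1)%N -> S j = c j + S j.+1 by move=> jk; rewrite /S big_ltn.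
rewrite big_add1/=.
have -> : \sum_(0 <= j < k) S j.+1 * X j =
    S 1%N * X 0%N + \sum_(1 <= j < k.+1) S j.+1 * X j.
  transitivity (\sum_(0 <= j < k.+1) S j.+1 * X j); last by rewrite big_ltn.
  by rewrite big_nat_recr//= /S [X in _ = _ + X * _]big_geq// mul0r addr0.
rewrite -addrA; congr (_ + _).
rewrite -sumrB -sumrN; apply: eq_big_nat => j /andP[_ jk].
by rewrite (SS j jk); ring.
Qed.

Lemma CbarE (k : nat) (Cs : nat -> R) j : (j < k)%N ->
  Cbar k Cs j = \sum_(j <= i < k) Cs i.
Proof.
case: k => // k jk; rewrite /Cbar/= -[in RHS](add0n j) big_addn big_nat_rev/=.
rewrite subSn//; apply: eq_big_nat => i ik; congr Cs.
by lia.
Qed.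

(** Integrability travels with the value, since additivity of the integral requires it. *)
Definition has_Rintegral (a b : R) (f : R -> R) (v : R) : Prop :=
  mu.-integrable `]a, b[ (EFin \o f) /\ \int[mu]_(t in `]a, b[) f t = v.

Lemma has_RintegralD a b f g v v' : has_Rintegral a b f v ->
  has_Rintegral a b g v' -> has_Rintegral a b (fun t => f t + g t) (v + v').
Proof.
move=> [fi <-] [gi <-]; split; first exact: integrableD_EFin.
by rewrite RintegralD.
Qed.

Lemma has_RintegralZ a b f v r : has_Rintegral a b f v ->
  has_Rintegral a b (fun t => r * f t) (r * v).
Proof.
move=> [fi <-]; split; first exact: integrableZl_EFin.
by rewrite RintegralZl.
Qed.

Lemma has_Rintegral_sum a b (k : nat) (F : nat -> R -> R) (v : nat -> R) :
  (forall i, (i < k)%N -> has_Rintegral a b (F i) (v i)) ->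
  has_Rintegral a b (fun t => \sum_(0 <= i < k) F i t) (\sum_(0 <= i < k) v i).
Proof.
elim: k => [_|k IH Fv].
  rewrite big_geq//; under eq_fun do rewrite big_geq//.
  split; first exact: integrable_cst_itv.
  by rewrite Rintegral_cst// mul0r.
rewrite big_nat_recr//=; under eq_fun do rewrite big_nat_recr//=.
by apply: has_RintegralD; [apply: IH => i ik; apply: Fv; exact: ltnW|exact: Fv].
Qed.

End RealLemmas.

(** * Energy increment over one step *)

Section EnergyIncrement.
Context {R : realType} {H : completeNormedModType R} (ip : {dot H for idfun}).
Hypothesis ip_norm : forall x : H, ip x x = `|x| ^+ 2.
Variables (P : spectral_measure ip) (s p : R).
Notation mu := (@lebesgue_measure R).
Variables (eps beta gamma CL A Chat Ctilde tau K : R).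
Variables (N : H -> H -> R) (k : nat) (E : H -> R) (Cs : nat -> R).
Variables (u : nat -> H) (U dU : nat -> R -> H) (n : nat).
Hypotheses (beta_gt0 : 0 < beta) (gamma_gt0 : 0 < gamma) (CL_gt0 : 0 < CL).
Hypotheses (Chat_gt0 : 0 < Chat) (Ctilde_gt0 : 0 < Ctilde) (tau_gt0 : 0 < tau).
Hypotheses (beta_lt : beta < p) (gamma_lt : gamma < p) (p_le : p <= s).
Hypothesis pE : p = pk beta gamma k.
Hypothesis K_ge0 : 0 <= K.
Hypothesis coercive : forall c x, 0 <= c -> c <= s -> Vsp P s x ->
  Vnorm P c x ^+ 2 <= K * Vnorm P s x ^+ 2 /\
  `|x| ^+ 2 <= K * Vnorm P s x ^+ 2.
Hypothesis N_lip : lipschitz_nonlinearity P beta gamma CL N.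
Hypothesis E_chain : chain_rule P eps s N E.
Hypothesis CsP : is_Cstar k Cs.
Hypothesis UH1 : forall m : nat, (1 <= m)%N ->
  [/\ is_H1 P s (tn tau m.-1) (tn tau m) (U m) (dU m),
      U m (tn tau m.-1) = u m.-1 & U m (tn tau m) = u m].
Hypothesis U_scheme : scheme_step P eps A tau s p k N u n (U n.+1) (dU n.+1).
Hypotheses (k_gt0 : (0 < k)%N) (k_le_n : (k <= n)%N).

Let a := tn tau n.
Let b := tn tau n.+1.
Let T := tau ^+ k.
Let C1 := young_fst beta p Chat.
Let C2 := young_snd beta p Chat.
Let C3 := young_fst gamma p Ctilde.
Let C4 := young_snd gamma p Ctilde.
Let Ds j := sq_L2norm (fun x : H => `|x|) (tn tau (n - j)) (tn tau (n - j).+1)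
  (dU (n - j).+1).
Let Vs j := sq_L2norm (Vnorm P p) (tn tau (n - j)) (tn tau (n - j).+1)
  (dU (n - j).+1).
Let Q j := C3 * Ds j + C4 * (T * Vs j).
Let coef j t := 1 - \sum_(0 <= i < j) lagrange_basis k tau i (t - a).
Let thg := T `^ (gamma / p).
Let thb := T `^ (beta / p).

Let T_gt0 : 0 < T. Proof. exact: exprn_gt0. Qed.
Let p_gt0 : 0 < p. Proof. exact: lt_trans gamma_lt. Qed.
Let s_ge0 : 0 <= s. Proof. exact: le_trans (ltW p_gt0) p_le. Qed.
Let beta_le : beta <= s. Proof. exact: le_trans (ltW beta_lt) p_le. Qed.
Let gamma_le : gamma <= s. Proof. exact: le_trans (ltW gamma_lt) p_le. Qed.

Let tnB m : tn tau m.+1 - tn tau m = tau.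
Proof. by rewrite /tn -mulrBl -natrB// subSnn mul1r. Qed.

Let tn_lt m : tn tau m < tn tau m.+1.
Proof. by rewrite -subr_gt0 tnB. Qed.

Let thE : thg * thb = tau ^+ 2.
Proof.
rewrite /thg /thb -powRD; last by rewrite (gt_eqF T_gt0) implybT.
rewrite /T -powR_mulrn ?(ltW tau_gt0)// -powRrM -mulrDl.
have -> : k%:R * ((gamma + beta) / p) = 2%:R :> R.
  have k0 : k%:R != 0 :> R by rewrite pnatr_eq0 -lt0n.
  have bg0 : beta + gamma != 0 by rewrite gt_eqF// addr_gt0.
  by rewrite pE /pk; field; rewrite k0 bg0.
by rewrite powR_mulrn ?(ltW tau_gt0).
Qed.

Let uV m : (1 <= m)%N -> Vsp P s (u m).
Proof.
case: m => // m _; have [[Um _ _ _ _] _ <-] := UH1 m.+1 isT.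
by apply: Um; rewrite lexx ltW ?tn_lt.
Qed.

Let displacement m t : (1 <= m)%N -> tn tau m.-1 <= t <= tn tau m ->
  thg * Vnorm P gamma (u m.-1 - U m t) ^+ 2 <=
  tau * (2 * (C3 * sq_L2norm (fun x : H => `|x|) (tn tau m.-1) (tn tau m) (dU m) +
              C4 * (T * sq_L2norm (Vnorm P p) (tn tau m.-1) (tn tau m) (dU m)))).
Proof.
case: m => // m _ tm; have [H1 U0 _] := UH1 m.+1 isT.
have [Um _ _ _ _] := H1.
have g0 := ltW gamma_gt0.
have Ug r : tn tau m <= r <= tn tau m.+1 -> Vsp P gamma (U m.+1 r).
  by move=> /Um; exact: Vsp_le.
rewrite -U0 (Vnorm_distC ip ip_norm)//; last 2 first.
- by apply: Ug; rewrite lexx ltW// tn_lt.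
- exact: Ug.
have := H1_displacement ip ip_norm P s K _ _ _ _ K_ge0 coercive H1
  T gamma p Ctilde t (tn_lt m) tm T_gt0 gamma_gt0 gamma_lt p_le Ctilde_gt0.
by rewrite -[m.+1.-1]/m (tnB m).
Qed.

(** The states [x_j]: index 0 is the running value, index [i.+1] is [u^{n-i}]. The increment from
    [j] to [j.+1] thus lives on the step that starts at [t_{n-j}], whose cost is [Q j]. *)
Let point t j := if j is i.+1 then u (n - i) else U n.+1 t.

Let pointV t j : a <= t <= b -> (j <= k)%N -> Vsp P s (point t j).
Proof.
case: j => [|j] tab jk /=; first by have [[+ _ _ _ _] _ _] := UH1 n.+1 isT; exact.
by apply: uV; rewrite subn_gt0 (leq_trans jk).
Qed.

Let point_dist t j : a <= t <= b -> (j < k)%N ->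
  thg * Vnorm P gamma (point t j.+1 - point t j) ^+ 2 <= tau * (2 * Q j).
Proof.
case: j => [|j] tab jk.
  by rewrite /Q /Ds /Vs /= subn0; exact: (displacement n.+1).
have nj : (n - j = (n - j.+1).+1)%N by rewrite subnSK// (leq_trans (ltnW jk)).
rewrite /= nj; have [_ _ <-] := UH1 (n - j.+1).+1 isT.
rewrite /Q /Ds /Vs; apply: (displacement (n - j.+1).+1) => //.
by rewrite lexx ltW// tn_lt.
Qed.

Let Q_ge0 j : 0 <= Q j.
Proof.
have [C30 C40] := young_ge0 _ _ _ gamma_gt0 gamma_lt Ctilde_gt0.
have sq0 nrm x y f : 0 <= sq_L2norm nrm x y f :> R.
  by apply: Rintegral_ge0 => t _; exact: sqr_ge0.
apply: addr_ge0; apply: mulr_ge0 => //; first exact: sq0.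
  by apply: mulr_ge0; [exact: ltW|exact: sq0].
Qed.

Let Cs_range j : (j.+1 < k)%N -> (1 <= j.+1 <= k.-1)%N.
Proof. by move=> jk; rewrite /= -ltnS prednK. Qed.

(* C_j^* is replaced by C_j^* + eta, to be used as a Young weight even if it
   vanishes. *)
Section Perturbed.
Variable eta : R.
Hypothesis eta_gt0 : 0 < eta.
Let kap j := Cs j + eta.

Let Cs_ge0 j : (j < k)%N -> 0 <= Cs j.
Proof.
have [C0 Cj] := CsP; case: j => [_|j jk]; first by rewrite C0.
by have [] : 0 <= Cs j.+1 /\ _ := Cj j.+1 (Cs_range j jk).
Qed.

Let kap_gt0 j : (j < k)%N -> 0 < kap j.
Proof. by move=> /Cs_ge0 C0; rewrite /kap ltr_wpDl. Qed.

(** Majorant of the derivative of the energy. The [Q j] are constant in time, so only the squared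
    coefficients and the norms of [w'] have to be integrated. *)
Let growth t := - (`|dU n.+1 t| ^+ 2) + - A * (T * Vnorm P p (dU n.+1 t) ^+ 2) +
  CL * \sum_(0 <= j < k) (Q j / (kap j * tau) * coef j t ^+ 2 +
     kap j * (C1 * `|dU n.+1 t| ^+ 2 + C2 * (T * Vnorm P p (dU n.+1 t) ^+ 2))).

Let derivative_le t : a < t < b ->
  (forall v, Vsp P s v ->
     ip (dU n.+1 t) v + eps * Lpair P 1 (U n.+1 t) v + A * T * Lpair P p (dU n.+1 t) v
     = \sum_(0 <= i < k) lagrange_basis k tau i (t - a) * N (u (n - i)%N) v) ->
  dE P eps N (U n.+1 t) (dU n.+1 t) <= growth t.
Proof.
move=> tab sch; set x := dU n.+1 t.
have tab' : a <= t <= b by case/andP: tab => /ltW -> /ltW ->.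
have xs : Vsp P s x by have [[_ + _ _ _] _ _] := UH1 n.+1 isT; exact.
have xb : Vsp P beta x := Vsp_le ip P beta s x (ltW beta_gt0) beta_le xs.
have xp : Vsp P p x := Vsp_le ip P p s x (ltW p_gt0) p_le xs.
pose M j := N (point t j) x.
have dEE : dE P eps N (U n.+1 t) x = - (`|x| ^+ 2) + - A * (T * Vnorm P p x ^+ 2) +
    \sum_(0 <= j < k) coef j t * (M j.+1 - M j).
  rewrite -(abel_lagrange k tau (t - a) M k_gt0 tau_gt0) /M/= -sch//.
  rewrite /dE [Lpair P p x x]/Lpair !ip_norm -/(Vnorm P p x); ring.
rewrite dEE /growth lerD2l mulr_sumr; apply: ler_sum_nat => j /andP[_ jk].
have jV := pointV t j tab' (ltnW jk); have j1V := pointV t j.+1 tab' jk.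
have gV y : Vsp P s y -> Vsp P gamma y.
  by apply: Vsp_le => //; exact: ltW.
apply: le_trans (ler_norm _) _; rewrite normrM.
apply: (@le_trans _ _ (CL * (`|coef j t| *
    (Vnorm P gamma (point t j.+1 - point t j) * Vnorm P beta x)))).
  rewrite mulrCA ler_wpM2l// mulrA.
  exact: (lipschitz_pairing ip ip_norm P beta gamma CL N (point t j.+1)
    (point t j) x N_lip (gV _ j1V) (gV _ jV) xb).
rewrite ler_pM2l// [Q j / _ * _]mulrC.
apply: (young_product _ _ _ _ tau thg thb) => //.
- exact: Vnorm_ge0.
- exact: Vnorm_ge0.
- exact: kap_gt0.
- exact: powR_gt0.
- exact: powR_gt0.
- exact: point_dist.
- exact: (Vnorm_interpolation ip ip_norm P T beta p Chat x).
Qed.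

Let coef_integral j : (j < k)%N -> has_Rintegral a b (fun t => coef j t ^+ 2) (Cs j ^+ 2 * tau).
Proof.
move=> jk; have cc : continuous (fun t => coef j t ^+ 2).
  move=> t; apply: (@continuous_comp _ _ _ (coef j) (fun x : R => x ^+ 2)).
    exact: continuous_lagrange_tail.
  exact: exprn_continuous.
split.
  apply: (@integrableS _ _ _ mu `[a, b]%classic) => //; last first.
    apply: continuous_compact_integrable; first exact: segment_compact.
    exact: continuous_subspaceT.
  exact: subset_itv_oo_cc.
(* For [j = 0] the coefficient is the constant 1, in agreement with [Cs 0 = 1]; [is_Cstar] provides
   the norms for [j >= 1]. *)
have [C0 Cj] := CsP; case: j jk {cc} => [_|j jk].
  rewrite C0 expr1n mul1r -(tnB n) /coef.
  under eq_Rintegral do rewrite big_geq// subr0 expr1n.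
  by rewrite Rintegral_cst//= lebesgue_measure_itv/= lte_fin tn_lt mul1r.
have [_ /(_ tau n tau_gt0)] := Cj j.+1 (Cs_range j jk).
move=> /(congr1 (fun z => z ^+ 2)); rewrite exprMn !sqr_sqrtr ?(ltW tau_gt0)//.
by apply: Rintegral_ge0 => t _; exact: sqr_ge0.
Qed.

Lemma energy_increment_perturbed :
  E (u n.+1) - E (u n) <= - Ds 0 - A * (T * Vs 0) +
    CL * \sum_(0 <= j < k) kap j * (Q j + (C1 * Ds 0 + C2 * (T * Vs 0))).
Proof.
have [H1 U0 U1] := UH1 n.+1 isT; rewrite -U1 -U0.
have [acE dE_ae] := E_chain _ _ _ _ (tn_lt n) H1.
have iN : has_Rintegral a b (fun t => `|dU n.+1 t| ^+ 2) (Ds 0).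
  split; first exact: (integrable_norm_sqr ip ip_norm P s K _ _ _ _ K_ge0 coercive H1).
  by rewrite /Ds subn0.
have iV : has_Rintegral a b (fun t => Vnorm P p (dU n.+1 t) ^+ 2) (Vs 0).
  split; last by rewrite /Vs subn0.
  exact: (integrable_Vnorm_sqr ip ip_norm P s K _ _ _ _ K_ge0 coercive H1 _
    (ltW p_gt0) p_le).
have ig : has_Rintegral a b growth (- Ds 0 + - A * (T * Vs 0) +
    CL * \sum_(0 <= j < k) (Q j / (kap j * tau) * (Cs j ^+ 2 * tau) +
       kap j * (C1 * Ds 0 + C2 * (T * Vs 0)))).
  apply: has_RintegralD.
    apply: has_RintegralD; last by do 2 apply: has_RintegralZ.
    have := has_RintegralZ _ _ _ _ (- 1) iN.
    by rewrite mulN1r; under eq_fun do rewrite mulN1r.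
  apply: has_RintegralZ; apply: has_Rintegral_sum => j jk.
  apply: has_RintegralD; first by apply: has_RintegralZ; exact: coef_integral.
  apply: has_RintegralZ; apply: has_RintegralD; first exact: has_RintegralZ.
  by do 2 apply: has_RintegralZ.
apply: (@le_trans _ _ (\int[mu]_(t in `]a, b[) growth t)).
  apply: (absolutely_continuous_le_integral (E \o U n.+1) growth a b (tn_lt n) acE ig.1).
  move: dE_ae U_scheme; apply: filterS2; first exact: (ae_filter_ringOfSetsType mu).
  move=> t dEt scht tab; exists (dE P eps N (U n.+1 t) (dU n.+1 t)); first exact: dEt.
  by apply: derivative_le => // v vs; exact: scht.
rewrite ig.2 mulNr lerD2l ler_pM2l//; apply: ler_sum_nat => j /andP[_ jk].
rewrite [leRHS]mulrDr lerD2r [leRHS]mulrC.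
have kj := kap_gt0 j jk; have Cj := Cs_ge0 j jk.
(* The [tau] from the integral cancels the one in the Young term, and [Cs j ^+ 2 / kap j <= kap j]
   because [Cs j <= kap j]. *)
rewrite (_ : _ * _ = Q j * (Cs j ^+ 2 / kap j)); last first.
  by field; rewrite !gt_eqF.
rewrite ler_wpM2l// ler_pdivrMr// -expr2 lerXn2r ?nnegrE ?(ltW kj)//.
by rewrite /kap lerDl ltW.
Qed.

End Perturbed.

(** Limit [eta -> 0]: the excess in the perturbed bound is [eta * W], and [eta = e / (W + 1)] keeps
    it below [e] even if [W] is 0. *)
Lemma energy_increment :
  E (u n.+1) - E (u n) <= - Ds 0 - A * (T * Vs 0) +
    CL * \sum_(0 <= j < k) Cs j * (Q j + (C1 * Ds 0 + C2 * (T * Vs 0))).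
Proof.
set Y := C1 * Ds 0 + _.
have Y0 : 0 <= Y.
  have [C10 C20] := young_ge0 _ _ _ beta_gt0 beta_lt Chat_gt0.
  have sq0 nrm x y f : 0 <= sq_L2norm nrm x y f :> R.
    by apply: Rintegral_ge0 => t _; exact: sqr_ge0.
  apply: addr_ge0; apply: mulr_ge0 => //; first exact: sq0.
  by apply: mulr_ge0; [exact: ltW|exact: sq0].
set W := CL * \sum_(0 <= j < k) (Q j + Y).
have W0 : 0 <= W by rewrite mulr_ge0 ?(ltW CL_gt0)// sumr_ge0// => j _; rewrite addr_ge0.
apply/ler_addgt0Pr => e e0.
have W1 : 0 < W + 1 by rewrite ltr_wpDl.
apply: le_trans (energy_increment_perturbed (e / (W + 1)) _) _; first exact: divr_gt0.
rewrite -[leRHS]addrA lerD2l; under eq_bigr do rewrite mulrDl.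
rewrite big_split/= mulrDr lerD2l -mulr_sumr mulrCA -/W.
by rewrite mulrAC ler_pdivrMr// ler_wpM2l ?(ltW e0)// lerDl.
Qed.

End EnergyIncrement.

(** * Decay of the modified energy *)

Theorem theorem2p3 (R : realType) (H : completeNormedModType R)
  (ip : {dot H for idfun})
  (ip_norm : forall x : H, ip x x = `|x| ^+ 2)
  (D : set H) (L : H -> H)
  (L_sa : self_adjoint ip D L) (L_pos : positive_definite ip D L)
  (P : spectral_measure ip) (L_P : spectral_resolution D L P)
  (eps beta gamma CL : R)
  (eps_gt0 : 0 < eps) (beta_gt0 : 0 < beta) (gamma_gt0 : 0 < gamma)
  (CL_gt0 : 0 < CL)
  (N : H -> H -> R) (N_lip : lipschitz_nonlinearity P beta gamma CL N)
  (k : nat) (k_ge2 : (2 <= k)%N)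
  (E : H -> R)
  (E_var : variational_derivative P eps (regularity beta gamma k) N E)
  (E_chain : chain_rule P eps (regularity beta gamma k) N E)
  (Cs : nat -> R) (CsP : is_Cstar k Cs)
  (Chat Ctilde A : R)
  (Chat_gt0 : 0 < Chat) (Ctilde_gt0 : 0 < Ctilde) (A_gt0 : 0 < A) :
  let p := pk beta gamma k in
  let s := regularity beta gamma k in
  let C1 := young_fst beta p Chat in
  let C2 := young_snd beta p Chat in
  let C3 := young_fst gamma p Ctilde in
  let C4 := young_snd gamma p Ctilde in
  CL * C3 * Cbar k Cs 1 <= 1 - CL * (C3 + C1 * Cbar k Cs 0) ->
  CL * C4 * Cbar k Cs 1 <= A - CL * (C4 + C2 * Cbar k Cs 0) ->
  forall (tau : R), 0 < tau ->
  forall (u : nat -> H) (U dU : nat -> R -> H),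
  (forall m : nat, (1 <= m)%N ->
     [/\ is_H1 P s (tn tau m.-1) (tn tau m) (U m) (dU m),
         U m (tn tau m.-1) = u m.-1 & U m (tn tau m) = u m]) ->
  (forall n : nat, (k <= n.+1)%N ->
     scheme_step P eps A tau s p k N u n (U n.+1) (dU n.+1)) ->
  forall n : nat, (k <= n)%N ->
    modified_energy P E CL C3 C4 p tau k Cs u dU n.+1
    <= modified_energy P E CL C3 C4 p tau k Cs u dU n.
Proof.
move=> p s C1 C2 C3 C4 cond1 cond2 tau tau0 u U dU UH1 scheme n kn.
have k0 : (0 < k)%N by exact: ltnW.
have bg0 : 0 < beta + gamma by exact: addr_gt0.
(* [k >= 2] gives [k / 2 >= 1]; thus [beta] and [gamma] lie strictly below [p], as the Young
   exponents require. *)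
have p_ge : beta + gamma <= p.
  rewrite /p /pk -mulrA ler_peMr ?(ltW bg0)// ler_pdivlMr// mul1r.
  by rewrite (ler_nat R 2 k).
have beta_lt : beta < p by rewrite (lt_le_trans _ p_ge)// ltrDl.
have gamma_lt : gamma < p by rewrite (lt_le_trans _ p_ge)// ltrDr.
have p_le : p <= s by rewrite /s /regularity !le_max lexx !orbT.
have [c c0 Pc] := spectral_gap ip ip_norm P D L L_pos L_P.
pose K := 1 + (1 + c `^ (- s)).
have K0 : 0 <= K by rewrite !addr_ge0// powR_ge0.
have coercive d x : 0 <= d -> d <= s -> Vsp P s x ->
    Vnorm P d x ^+ 2 <= K * Vnorm P s x ^+ 2 /\
    `|x| ^+ 2 <= K * Vnorm P s x ^+ 2.
  exact: Vnorm_coercive.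
have kSn : (k <= n.+1)%N by exact: leqW.
have := energy_increment ip ip_norm P s p eps beta gamma CL A Chat Ctilde tau K
  N k E Cs u U dU n beta_gt0 gamma_gt0 CL_gt0 Chat_gt0 Ctilde_gt0 tau0
  beta_lt gamma_lt p_le erefl K0 coercive N_lip E_chain CsP UH1 (scheme n kSn)
  k0 kn.
set Ds := fun j => sq_L2norm (fun x : H => `|x|) (tn tau (n - j))
  (tn tau (n - j).+1) (dU (n - j).+1).
set Vs := fun j => sq_L2norm (Vnorm P p) (tn tau (n - j)) (tn tau (n - j).+1)
  (dU (n - j).+1).
rewrite -/C1 -/C2 -/C3 -/C4 -/(Ds 0%N) -/(Vs 0%N).
under eq_bigr => j _ do rewrite -/(Ds j) -/(Vs j).
have Cbar_sum j : (j < k)%N -> Cbar k Cs j = \sum_(j <= i < k) Cs i.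
  exact: CbarE.
have sumE (X : nat -> R) : \sum_(1 <= j < k) Cbar k Cs j * X j =
    \sum_(1 <= j < k) (\sum_(j <= i < k) Cs i) * X j.
  by apply: eq_big_nat => j /andP[_ jk]; rewrite Cbar_sum.
(* The memory at [n.+1] is the memory at [n] shifted by one index, the form that [telescoping_tail]
   treats. *)
have shift j : (0 < j < k)%N -> (n.+1 - j = n - j.-1)%N.
  by case: j => // j /andP[_ jk]; rewrite subSS.
have E1 : modified_energy P E CL C3 C4 p tau k Cs u dU n.+1 = E (u n.+1)
    + CL * C3 * (\sum_(1 <= j < k) Cbar k Cs j * Ds j.-1)
    + CL * C4 * (\sum_(1 <= j < k) Cbar k Cs j * (tau ^+ k * Vs j.-1)).
  by congr (_ + _ * _ + _ * _); apply: eq_big_nat => j /shift ->.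
have E0 : modified_energy P E CL C3 C4 p tau k Cs u dU n = E (u n)
    + CL * C3 * (\sum_(1 <= j < k) Cbar k Cs j * Ds j)
    + CL * C4 * (\sum_(1 <= j < k) Cbar k Cs j * (tau ^+ k * Vs j)) by [].
rewrite E1 E0 !sumE.
have := telescoping_tail k Cs Ds k0.
have := telescoping_tail k Cs (fun j => tau ^+ k * Vs j) k0.
rewrite -(Cbar_sum 1%N k_ge2).
(* The term [j = 0], with [Cs 0 = 1], belongs to the current step and is split off; the terms
   [j >= 1] concern past steps and are to be cancelled. *)
have -> : \sum_(0 <= j < k) Cs j * (C3 * Ds j + C4 * (tau ^+ k * Vs j) +
      (C1 * Ds 0%N + C2 * (tau ^+ k * Vs 0%N))) =
    C3 * Ds 0%N + C4 * (tau ^+ k * Vs 0%N)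
    + C3 * (\sum_(1 <= j < k) Cs j * Ds j)
    + C4 * (\sum_(1 <= j < k) Cs j * (tau ^+ k * Vs j))
    + Cbar k Cs 0 * (C1 * Ds 0%N + C2 * (tau ^+ k * Vs 0%N)).
  under eq_bigr do rewrite mulrDr; rewrite big_split/= -mulr_suml -Cbar_sum//.
  congr (_ + _); rewrite big_ltn// (CsP.1) mul1r -!addrA; congr (_ + (_ + _)).
  rewrite !mulr_sumr -big_split/=; apply: eq_bigr => j _; ring.
have D0 : 0 <= Ds 0%N by apply: Rintegral_ge0 => t _; exact: sqr_ge0.
have V0 : 0 <= tau ^+ k * Vs 0%N.
  apply: mulr_ge0; first by rewrite exprn_ge0 ?ltW.
  by apply: Rintegral_ge0 => t _; exact: sqr_ge0.
have := ler_wpM2r D0 cond1; have := ler_wpM2r V0 cond2.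
move: D0 V0; set d := Ds 0%N; set v := tau ^+ k * Vs 0%N.
set SD := \sum_(1 <= j < k) Cs j * Ds j.
set SV := \sum_(1 <= j < k) Cs j * (tau ^+ k * Vs j).
set XD := \sum_(1 <= j < k) _ * Ds j.-1; set YD := \sum_(1 <= j < k) _ * Ds j.
set XV := \sum_(1 <= j < k) _ * (_ * Vs j.-1).
set YV := \sum_(1 <= j < k) _ * (_ * Vs j).
move=> D0 V0 c2 c1 tV tD.
(* The past sums [SD] and [SV] cancel those of the energy increment; [d] and [v] remain, with the
   coefficients that the two hypotheses make nonpositive. *)
have {tV} -> : XV = Cbar k Cs 1 * v - SV + YV by rewrite -tV; ring.
have {tD} -> : XD = Cbar k Cs 1 * d - SD + YD by rewrite -tD; ring.
move: (Cbar k Cs 1) (Cbar k Cs 0) c1 c2 => S1 S0 c1 c2; lra.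
Qed.
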